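(* Let $G(\Delta)\in\mathcal G_4$ (zero-feedthrough plant class) and $\gamma>0$ be given. The following two statements are equivalent. (i) There exist a structured controller $K(\Delta)\in\mathcal K_4$ with $r^c=s^c=:l^c$, symmetric $\mathcal X_1\succ0$ and $\mathcal P\in\mathbf P$ such that the closed-loop matrices of the lifted plant with $K(\Delta)$ satisfy $$\mathcal N^T\mathrm{diag}\!\left(\begin{pmatrix}0&\mathcal X_1\\ \mathcal X_1&0\end{pmatrix},\begin{pmatrix}0&\mathcal P\\ \mathcal P&0\end{pmatrix},\begin{pmatrix}-\gamma I&0\\0&I\end{pmatrix}\right)\mathcal N\prec0,\qquad \mathcal N=\begin{pmatrix}I&0&0\\ \mathcal A_{11}&\mathcal A_{12}&\mathcal B_1\\0&I&0\\ \mathcal A_{21}&\mathcal A_{22}&\mathcal B_2\\0&0&I\\ \mathcal C_1&\mathcal C_2&\mathcal D\end{pmatrix}.\tag{1}$$ (ii) There exist symmetric $X_1,Y_1\in\mathbb R^{n\times n}$, multiplier variables $(P_3,Q_1,P_{\mu\nu},Q_{\mu\nu},R_{\mu\nu})$ with $P_3\in\mathbf P_p$, $Q_1\in\mathbf P_d$, and controller variables $\mathsf K_{ij},\mathsf L_i,\mathsf M_j,\mathsf N$ ($i,j=1,2$), all as described in the context, such that $$\mathbb N^T\mathrm{diag}\!\left(\begin{pmatrix}0&I\\ I&0\end{pmatrix},\begin{pmatrix}0&I\\ I&0\end{pmatrix},\begin{pmatrix}-\gamma I&0\\0&I\end{pmatrix}\right)\mathbb N\prec0,\qquad \mathbb N=\begin{pmatrix}I&0&0\\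 \mathbb A_{11}&\mathbb A_{12}&\mathbb B_1\\0&I&0\\ \mathbb A_{21}&\mathbb A_{22}&\mathbb B_2\\0&0&I\\ \mathbb C_1&\mathbb C_2&\mathbb D\end{pmatrix},\qquad \mathbb X:=\begin{pmatrix}Y_1&I\\ I&X_1\end{pmatrix}\succ0,$$ $$P_2^T\Delta_l(\Delta)Q_2+\bigl(P_2^T\Delta_l(\Delta)Q_2\bigr)^T\succ0\quad\text{for all }\Delta\in\mathbf V,$$ where, for $i,j=1,2$, $$\begin{pmatrix}\mathbb A_{ij}&\mathbb B_i\\ \mathbb C_j&\mathbb D\end{pmatrix}:=\begin{pmatrix}A_{ij}Y_j&A_{ij}&B_i^p\\0&X_i^TA_{ij}&X_i^TB_i^p\\ C_j^pY_j&C_j^p&D^p\end{pmatrix}+\begin{pmatrix}0&B_i\\ I&0\\0&E\end{pmatrix}\begin{pmatrix}K_{ij}&L_i\\ M_j&N\end{pmatrix}\begin{pmatrix}I&0&0\\0&C_j&F\end{pmatrix}$$ with $N:=\mathsf N$, $L_i:=\mathsf L_i$, $M_j:=\mathsf M_j$, $K_{ij}:=\mathsf K_{ij}$ if $(i,j)\ne(2,2)$, and $$K_{22}:=\mathsf K_{22}+\mathscr U(X_2^TA_{22}Y_2).$$ Moreover, if the conditions in (ii) are satisfied, then there exist $\mathcal X_1\succ0$, $\mathcal P\in\mathbf P$ and $K(\Delta)\in\mathcal K_4$ with an affine, lower block triangular scheduling function $\hat\Delta_c(\cdot)$ such that (1) holds, where the sizes of $\hat A^c_{11}$ and $\hat A^c_{22}$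 are bounded by $n\times n$ and $2|l|\times2|l|$, respectively.
   Context: All matrices are real. $\prec 0$/$\succ0$ mean negative/positive definite for symmetric matrices. For a tuple $a$ of nonnegative integers, $|a|$ is the sum of its entries; $a\times b$ matrices are $|a|\times|b|$ matrices with induced block partition. $\mathbf V=\mathrm{Co}\{\Delta_1,\dots,\Delta_N\}\subset\mathbb R^{r_\Delta\times s_\Delta}$ is the convex hull of finitely many matrices, with $0\in\mathbf V$. For $a,b\in\mathbb N_0^2$, an $a\times b$ matrix is lower block triangular if it has the form $\begin{pmatrix}J_{11}&0\\ J_{21}&J_{22}\end{pmatrix}$, $J_{\mu\nu}\in\mathbb R^{a_\mu\times b_\nu}$. For a $2\times2$ block matrix, $\mathscr U\begin{pmatrix}J_{11}&J_{12}\\ J_{21}&J_{22}\end{pmatrix}:=\begin{pmatrix}0&J_{12}\\0&0\end{pmatrix}$. Class $\mathcal G_4$ (plants): $$\begin{pmatrix}\dot x\\ \hat z\\ z_p\\ y\end{pmatrix}=\begin{pmatrix}\hat A_{11}&\hat A_{12}&\hat B_1^p&\hat B_1\\ \hat A_{21}&\hat A_{22}&\hat B_2^p&\hat B_2\\ \hat C_1^p&\hat C_2^p&\hat D^p&\hat E\\ \hat C_1&\hat C_2&\hat F&0\end{pmatrix}\begin{pmatrix}x\\ \hat w\\ w_p\\ u\end{pmatrix},\quad \hat w=\hat\Delta(\Delta)\hat z,\quad \hat\Delta(\Delta)=\begin{pmatrix}\Delta&0\\0&\Delta\end{pmatrix},$$ $x,\hat w,\hat z,w_p,z_p,u,y$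 of dimensions $n,|r|,|s|,m^p,k^p,m,k$ with $n,m,k$ integers, $r=(r_1,r_2)=(r_\Delta,r_\Delta)$, $s=(s_1,s_2)=(s_\Delta,s_\Delta)$; $\hat A_{22}$ is lower block triangular (partition $s\times r$), the first $s_1$ rows of $\hat B_2^p$ are zero, the last $r_2$ columns of $\hat C_2^p$ are zero, $\hat D^p=0$, and all other matrices are unstructured. Class $\mathcal K_4$ (controllers): $$\begin{pmatrix}\dot x_c\\ \hat z_c\\ u\end{pmatrix}=\begin{pmatrix}\hat A^c_{11}&\hat A^c_{12}&\hat B^c_1\\ \hat A^c_{21}&\hat A^c_{22}&\hat B^c_2\\ \hat C^c_1&\hat C^c_2&\hat D^c\end{pmatrix}\begin{pmatrix}x_c\\ \hat w_c\\ y\end{pmatrix},\quad \hat w_c=\hat\Delta_c(\Delta)\hat z_c,$$ with $x_c,\hat w_c,\hat z_c$ of dimensions $n^c,|r^c|,|s^c|$ for free $n^c\in\mathbb N_0$, $r^c,s^c\in\mathbb N_0^2$; $\hat A^c_{22}$ is lower block triangular ($s^c\times r^c$), the first $s^c_1$ rows of $\hat B^c_2$ are zero, the last $r^c_2$ columns of $\hat C^c_2$ are zero, $\hat D^c=0$, all other matrices are unstructured, and $\hat\Delta_c:\mathbf V\to\mathbb R^{r^c\times s^c}$ is a function with lower block triangular values. Lifted plant, with $l:=(r,s)=(r_1,r_2,s_1,s_2)$, $|l|=|r|+|s|$: $A_{11}=\hat A_{11}$, $A_{12}=(\hat A_{12}\ \ 0)$, $A_{21}=\begin{pmatrix}0\\2\hat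 A_{21}\end{pmatrix}$, $A_{22}=\begin{pmatrix}I_{|r|}&0\\2\hat A_{22}&-I_{|s|}\end{pmatrix}$, $B_1^p=\hat B_1^p$, $B_2^p=\begin{pmatrix}0\\2\hat B_2^p\end{pmatrix}$, $B_1=\hat B_1$, $B_2=\begin{pmatrix}0\\2\hat B_2\end{pmatrix}$, $C_1^p=\hat C_1^p$, $C_2^p=(\hat C_2^p\ \ 0)$, $C_1=\hat C_1$, $C_2=(\hat C_2\ \ 0)$, $D^p=\hat D^p$, $E=\hat E$, $F=\hat F$, $\Delta_l(\Delta)=\begin{pmatrix}-I_{|r|}&2\hat\Delta(\Delta)\\0&I_{|s|}\end{pmatrix}$. Closed loop of the lifted plant with the controller ($r^c=s^c=l^c$): for $i,j=1,2$, $$\begin{pmatrix}\mathcal A_{ij}&\mathcal B_i\\ \mathcal C_j&\mathcal D\end{pmatrix}=\begin{pmatrix}A_{ij}&0&B_i^p\\0&0&0\\ C_j^p&0&D^p\end{pmatrix}+\begin{pmatrix}0&B_i\\ I&0\\0&E\end{pmatrix}\begin{pmatrix}\hat A^c_{ij}&\hat B^c_i\\ \hat C^c_j&\hat D^c\end{pmatrix}\begin{pmatrix}0&I&0\\ C_j&0&F\end{pmatrix},$$ $\Delta_{lc}(\Delta):=\mathrm{diag}(\Delta_l(\Delta),\hat\Delta_c(\Delta))$, and $\mathbf P$ (depending on $\hat\Delta_c$) is the set of symmetric $\mathcal P$ of size $|l|+|l^c|$ with $\begin{pmatrix}\Delta_{lc}(\Delta)\\ I\end{pmatrix}^T\begin{pmatrix}0&\mathcal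 P\\ \mathcal P&0\end{pmatrix}\begin{pmatrix}\Delta_{lc}(\Delta)\\ I\end{pmatrix}\succ0$ for all $\Delta\in\mathbf V$. Scaling classes: $\mathbf P_p$ is the set of symmetric $P$ of size $|l|$ with $\begin{pmatrix}I_{|r|}\\0\end{pmatrix}^TP\begin{pmatrix}I_{|r|}\\0\end{pmatrix}\prec0$ and $\begin{pmatrix}\hat\Delta(\Delta)\\ I_{|s|}\end{pmatrix}^TP\begin{pmatrix}\hat\Delta(\Delta)\\ I_{|s|}\end{pmatrix}\succ0$ for all $\Delta\in\mathbf V$; $\mathbf P_d$ is the set of symmetric $\tilde P$ of size $|l|$ with $\begin{pmatrix}0\\ I_{|s|}\end{pmatrix}^T\tilde P\begin{pmatrix}0\\ I_{|s|}\end{pmatrix}\succ0$ and $\begin{pmatrix}I_{|r|}\\-\hat\Delta(\Delta)^T\end{pmatrix}^T\tilde P\begin{pmatrix}I_{|r|}\\-\hat\Delta(\Delta)^T\end{pmatrix}\prec0$ for all $\Delta\in\mathbf V$. Multiplier variables: $P_3\in\mathbf P_p$, $Q_1\in\mathbf P_d$, symmetric $\begin{pmatrix}P_{22}&P_{23}\\P_{32}&P_{33}\end{pmatrix}$ of partition $(r_1,s_1)$, symmetric $\begin{pmatrix}Q_{22}&Q_{23}\\Q_{32}&Q_{33}\end{pmatrix}$ of partition $(r_2,s_2)$, and $\begin{pmatrix}R_{22}&R_{23}\\R_{32}&R_{33}\end{pmatrix}$ of partition $(r_2,s_2)\times(r_1,s_1)$; set, in the partition $(r_1,r_2,s_1,s_2)$,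 $$P_2:=\begin{pmatrix}P_{22}&R_{22}^T&P_{23}&R_{32}^T\\0&I_{r_2}&0&0\\P_{32}&R_{23}^T&P_{33}&R_{33}^T\\0&0&0&I_{s_2}\end{pmatrix},\quad Q_2:=\begin{pmatrix}I_{r_1}&0&0&0\\-R_{22}&Q_{22}&-R_{23}&Q_{23}\\0&0&I_{s_1}&0\\-R_{32}&Q_{32}&-R_{33}&Q_{33}\end{pmatrix},$$ $$X_2:=(P_2\ \ P_3)\in\mathbb R^{|l|\times2|l|},\qquad Y_2:=(Q_1\ \ Q_2)\in\mathbb R^{|l|\times2|l|}.$$ Controller variables, with $b=v:=(|l|,|l|)$: $\mathsf K_{11}\in\mathbb R^{n\times n}$, $\mathsf K_{12}\in\mathbb R^{n\times2|l|}$, $\mathsf K_{21}\in\mathbb R^{2|l|\times n}$, $\mathsf L_1\in\mathbb R^{n\times k}$, $\mathsf M_1\in\mathbb R^{m\times n}$ unstructured; $\mathsf K_{22}$ lower block triangular of partition $b\times v$; $\mathsf L_2\in\mathbb R^{2|l|\times k}$ with first $|l|$ rows zero; $\mathsf M_2\in\mathbb R^{m\times2|l|}$ with last $|l|$ columns zero; $\mathsf N=0\in\mathbb R^{m\times k}$. $\mathscr U$ is applied in the partition $b\times v$. *)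

(* Defs.v *)
From HB Require Import structures.
From mathcomp Require Export all_boot all_order all_algebra.
From mathcomp Require Export classical_sets reals.

Set Implicit Arguments.
Unset Strict Implicit.
Unset Printing Implicit Defensive.
Import Order.TTheory GRing.Theory Num.Theory.
Local Open Scope classical_set_scope.
Local Open Scope ring_scope.

Lemma symmetricmxP (R : realType) n (M : 'M[R]_n) :
  reflect (M^T = M) (M \is symmetricmx).
Proof.
have -> : (M \is symmetricmx) = (M == M^T).
  by rewrite qualifE /= expr0 scale1r map_mx_id.
by rewrite eq_sym; apply: eqP.
Qed.

Definition posdef (R : realType) n (M : 'M[R]_n) : Prop :=
  M \is symmetricmx /\ forall x : 'cV[R]_n, x != 0 -> 0 < (x^T *m M *m x) 0 0.

Definition negdef (R : realType) n (M : 'M[R]_n) : Prop :=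
  M \is symmetricmx /\ forall x : 'cV[R]_n, x != 0 -> (x^T *m M *m x) 0 0 < 0.

Definition convex_hull (R : realType) p q N (D : 'I_N -> 'M[R]_(p, q)) :
    set 'M[R]_(p, q) :=
  [set M | exists w : 'I_N -> R,
     [/\ forall i, 0 <= w i, \sum_i w i = 1 & M = \sum_i w i *: D i]].

Definition affine_on (R : realType) p q p' q' (V : set 'M[R]_(p, q))
    (f : 'M[R]_(p, q) -> 'M[R]_(p', q')) : Prop :=
  exists (L : {linear 'M[R]_(p, q) -> 'M[R]_(p', q')}) (C : 'M[R]_(p', q')),
    forall M, V M -> f M = L M + C.

Definition lower_block_triangular (R : realType) a1 a2 b1 b2
  (J : 'M[R]_(a1 + a2, b1 + b2)) : Prop := ursubmx J = 0.

(* The operator U of the synthesis LMIs: only the (1,2) block is kept. *)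
Definition upper_part (R : realType) a1 a2 b1 b2
    (J : 'M[R]_(a1 + a2, b1 + b2)) : 'M[R]_(a1 + a2, b1 + b2) :=
  block_mx 0 (ursubmx J) 0 0.

Definition diag2 (R : realType) a b c d (A : 'M[R]_(a, b)) (B : 'M[R]_(c, d)) :
  'M[R]_(a + c, b + d) := block_mx A 0 0 B.

Definition antidiag2 (R : realType) a (A : 'M[R]_a) : 'M[R]_(a + a) :=
  block_mx 0 A A 0.

(* The real matrix of a linear map (x, w, i) |-> (x', z, o), where x, w, z, i, o
   have dimensions nx, nw, nz, ni, no.  It serves for the performance part of a
   plant, for a controller (i = y, o = u), for the controller variables
   (A_ij, B_i, C_j, D) = (K_ij, L_i, M_j, N), and for closed loops. *)
Record system (R : realType) (nx nw nz ni no : nat) := System {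
  A11 : 'M[R]_(nx, nx); A12 : 'M[R]_(nx, nw); B1 : 'M[R]_(nx, ni);
  A21 : 'M[R]_(nz, nx); A22 : 'M[R]_(nz, nw); B2 : 'M[R]_(nz, ni);
  C1 : 'M[R]_(no, nx);  C2 : 'M[R]_(no, nw);  D : 'M[R]_(no, ni) }.

(* An open-loop plant: its performance part w_p |-> z_p is (A_ij, B^p_i, C^p_j, D^p);
   the feedthrough from u to y is zero by construction. *)
Record plant (R : realType) (nx nw nz mp kp m k : nat) := Plant {
  perf :> system R nx nw nz mp kp;
  Bu1 : 'M[R]_(nx, m); Bu2 : 'M[R]_(nz, m); E : 'M[R]_(kp, m);
  Cy1 : 'M[R]_(k, nx); Cy2 : 'M[R]_(k, nw); F : 'M[R]_(k, mp) }.

Definition zero_feedthrough (R : realType) nx w1 w2 z1 z2 ni no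
    (S : system R nx (w1 + w2) (z1 + z2) ni no) : Prop :=
  [/\ lower_block_triangular (A22 S), usubmx (B2 S) = 0, rsubmx (C2 S) = 0
    & D S = 0].

Definition class_G4 (R : realType) n r1 r2 s1 s2 mp kp m k
  (G : plant R n (r1 + r2) (s1 + s2) mp kp m k) : Prop := zero_feedthrough G.

(* The scheduling function is total; only its values on V matter. *)
Definition class_K4 (R : realType) rD sD (V : set 'M[R]_(rD, sD))
    nc rc1 rc2 sc1 sc2 m k
    (K : system R nc (rc1 + rc2) (sc1 + sc2) k m)
    (Dc : 'M[R]_(rD, sD) -> 'M[R]_(rc1 + rc2, sc1 + sc2)) : Prop :=
  zero_feedthrough K /\ forall M, V M -> lower_block_triangular (Dc M).

Definition hatDelta (R : realType) rD sD (M : 'M[R]_(rD, sD)) :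
  'M[R]_(rD + rD, sD + sD) := diag2 M M.

Definition lifted_plant (R : realType) n r s mp kp m k (G : plant R n r s mp kp m k) :
    plant R n (r + s) (r + s) mp kp m k :=
  Plant
    (System
       (A11 G)                  (row_mx (A12 G) 0)                       (B1 G)
       (col_mx 0 (2 *: A21 G))  (block_mx 1%:M 0 (2 *: A22 G) (- 1%:M))  (col_mx 0 (2 *: B2 G))
       (C1 G)                   (row_mx (C2 G) 0)                        (D G))
    (Bu1 G) (col_mx 0 (2 *: Bu2 G)) (E G)
    (Cy1 G) (row_mx (Cy2 G) 0) (F G).

Definition Delta_l (R : realType) rD sD (M : 'M[R]_(rD, sD)) :
    'M[R]_((rD + rD) + (sD + sD)) :=
  block_mx (- 1%:M) (2 *: hatDelta M) 0 1%:M.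

Definition closed_loop_block (R : realType) p q pc qc mp kp m k
    (A : 'M[R]_(p, q)) (Bp : 'M[R]_(p, mp)) (Cp : 'M[R]_(kp, q)) (Dp : 'M[R]_(kp, mp))
    (Bu : 'M[R]_(p, m)) (E : 'M[R]_(kp, m)) (Cy : 'M[R]_(k, q)) (F : 'M[R]_(k, mp))
    (Ac : 'M[R]_(pc, qc)) (Bc : 'M[R]_(pc, k)) (Cc : 'M[R]_(m, qc)) (Dc : 'M[R]_(m, k)) :
    'M[R]_((p + pc) + kp, (q + qc) + mp) :=
  block_mx (block_mx A 0 0 0) (col_mx Bp 0) (row_mx Cp 0) Dp
  + col_mx (block_mx 0 Bu 1%:M 0) (row_mx 0 E)
    *m block_mx Ac Bc Cc Dc
    *m row_mx (block_mx 0 1%:M Cy 0) (col_mx 0 F).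

Lemma closed_loop_blockE (R : realType) p q pc qc mp kp m k
    (A : 'M[R]_(p, q)) (Bp : 'M[R]_(p, mp)) (Cp : 'M[R]_(kp, q)) (Dp : 'M[R]_(kp, mp))
    (Bu : 'M[R]_(p, m)) (E : 'M[R]_(kp, m)) (Cy : 'M[R]_(k, q)) (F : 'M[R]_(k, mp))
    (Ac : 'M[R]_(pc, qc)) (Bc : 'M[R]_(pc, k)) (Cc : 'M[R]_(m, qc)) (Dc : 'M[R]_(m, k)) :
  closed_loop_block A Bp Cp Dp Bu E Cy F Ac Bc Cc Dc =
  block_mx
    (block_mx (A + Bu *m Dc *m Cy) (Bu *m Cc) (Bc *m Cy) Ac)
    (col_mx (Bp + Bu *m Dc *m F) (Bc *m F))
    (row_mx (Cp + E *m Dc *m Cy) (E *m Cc))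
    (Dp + E *m Dc *m F).
Proof.
rewrite /closed_loop_block mul_col_mx mul_col_row.
rewrite mulmx_block mul_row_block.
rewrite !mul0mx !mul1mx !add0r !addr0.
rewrite mulmx_block mul_block_col mul_row_block mul_row_col.
rewrite !mulmx0 !mulmx1 !add0r !addr0.
by rewrite !add_block_mx add_col_mx add_row_mx !add0r.
Qed.

(* The (i,j) instance of [closed_loop_block] is partitioned as
   (A_ij, B_i; C_j, D); by [closed_loop_blockE] its B_i part does not depend on j,
   its C_j part not on i, and its D part on neither. *)
Definition closed_loop (R : realType) n w z mp kp m k nc wc zc
    (G : plant R n w z mp kp m k) (K : system R nc wc zc k m) :
    system R (n + nc) (w + wc) (z + zc) mp kp :=
  let c11 := closed_loop_block (A11 G) (B1 G) (C1 G) (D G) (Bu1 G) (E G) (Cy1 G) (F G)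
               (A11 K) (B1 K) (C1 K) (D K) in
  let c12 := closed_loop_block (A12 G) (B1 G) (C2 G) (D G) (Bu1 G) (E G) (Cy2 G) (F G)
               (A12 K) (B1 K) (C2 K) (D K) in
  let c21 := closed_loop_block (A21 G) (B2 G) (C1 G) (D G) (Bu2 G) (E G) (Cy1 G) (F G)
               (A21 K) (B2 K) (C1 K) (D K) in
  let c22 := closed_loop_block (A22 G) (B2 G) (C2 G) (D G) (Bu2 G) (E G) (Cy2 G) (F G)
               (A22 K) (B2 K) (C2 K) (D K) in
  System (ulsubmx c11) (ulsubmx c12) (ursubmx c11)
         (ulsubmx c21) (ulsubmx c22) (ursubmx c22)
         (dlsubmx c11) (dlsubmx c22) (drsubmx c11).

Definition outer_factor (R : realType) nx nw mp kp (S : system R nx nw nw mp kp) :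
    'M[R]_((nx + nx) + (nw + nw) + (mp + kp), nx + nw + mp) :=
  col_mx
    (col_mx
       (col_mx (row_mx (row_mx 1%:M 0) 0)
               (row_mx (row_mx (A11 S) (A12 S)) (B1 S)))
       (col_mx (row_mx (row_mx 0 1%:M) 0)
               (row_mx (row_mx (A21 S) (A22 S)) (B2 S))))
    (col_mx (row_mx 0 1%:M)
            (row_mx (row_mx (C1 S) (C2 S)) (D S))).

Definition middle (R : realType) nx nw mp kp (gamma : R) (X : 'M[R]_nx) (P : 'M[R]_nw) :
    'M[R]_((nx + nx) + (nw + nw) + (mp + kp)) :=
  diag2 (diag2 (antidiag2 X) (antidiag2 P)) (diag2 (- gamma%:M) 1%:M).

Definition performance_lmi (R : realType) nx nw mp kp (gamma : R)
    (X : 'M[R]_nx) (P : 'M[R]_nw) (S : system R nx nw nw mp kp) : Prop :=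
  negdef ((outer_factor S)^T *m middle mp kp gamma X P *m outer_factor S).

(* The class \mathbf P associated with the scheduling function Dc. *)
Definition full_scalings (R : realType) rD sD (V : set 'M[R]_(rD, sD)) lc
    (Dc : 'M[R]_(rD, sD) -> 'M[R]_lc) :
    set 'M[R]_((rD + rD) + (sD + sD) + lc) :=
  [set P | P \is symmetricmx /\
     forall M, V M ->
       let T := col_mx (diag2 (Delta_l M) (Dc M)) 1%:M in
       posdef (T^T *m antidiag2 P *m T)].

Definition primal_scalings (R : realType) rD sD (V : set 'M[R]_(rD, sD)) :
    set 'M[R]_((rD + rD) + (sD + sD)) :=
  [set P | [/\ P \is symmetricmx,
     let T := col_mx 1%:M 0 : 'M[R]_((rD + rD) + (sD + sD), rD + rD) in
       negdef (T^T *m P *m T)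
   & forall M, V M ->
       let T := col_mx (hatDelta M) 1%:M in posdef (T^T *m P *m T)]].

Definition dual_scalings (R : realType) rD sD (V : set 'M[R]_(rD, sD)) :
    set 'M[R]_((rD + rD) + (sD + sD)) :=
  [set P | [/\ P \is symmetricmx,
     let T := col_mx 0 1%:M : 'M[R]_((rD + rD) + (sD + sD), sD + sD) in
       posdef (T^T *m P *m T)
   & forall M, V M ->
       let T := col_mx 1%:M (- (hatDelta M)^T) in negdef (T^T *m P *m T)]].

(* With P = (P22 P23; P32 P33), Q = (Q22 Q23; Q32 Q33), R = (R22 R23; R32 R33). *)
Definition P2_of (R : realType) r1 r2 s1 s2
    (P : 'M[R]_(r1 + s1)) (Rm : 'M[R]_(r2 + s2, r1 + s1)) :
    'M[R]_((r1 + r2) + (s1 + s2)) :=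
  block_mx
    (block_mx (ulsubmx P) (ulsubmx Rm)^T 0 1%:M)
    (block_mx (ursubmx P) (dlsubmx Rm)^T 0 0)
    (block_mx (dlsubmx P) (ursubmx Rm)^T 0 0)
    (block_mx (drsubmx P) (drsubmx Rm)^T 0 1%:M).

Definition Q2_of (R : realType) r1 r2 s1 s2
    (Q : 'M[R]_(r2 + s2)) (Rm : 'M[R]_(r2 + s2, r1 + s1)) :
    'M[R]_((r1 + r2) + (s1 + s2)) :=
  block_mx
    (block_mx 1%:M 0 (- ulsubmx Rm) (ulsubmx Q))
    (block_mx 0    0 (- ursubmx Rm) (ursubmx Q))
    (block_mx 0    0 (- dlsubmx Rm) (dlsubmx Q))
    (block_mx 1%:M 0 (- drsubmx Rm) (drsubmx Q)).

Definition design_block (R : realType) p q p' q' mp kp m k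
    (A : 'M[R]_(p, q)) (Bp : 'M[R]_(p, mp)) (Cp : 'M[R]_(kp, q)) (Dp : 'M[R]_(kp, mp))
    (Bu : 'M[R]_(p, m)) (E : 'M[R]_(kp, m)) (Cy : 'M[R]_(k, q)) (F : 'M[R]_(k, mp))
    (X : 'M[R]_(p, p')) (Y : 'M[R]_(q, q'))
    (K : 'M[R]_(p', q')) (L : 'M[R]_(p', k)) (M : 'M[R]_(m, q')) (N : 'M[R]_(m, k)) :
    'M[R]_((p + p') + kp, (q' + q) + mp) :=
  block_mx (block_mx (A *m Y) A 0 (X^T *m A)) (col_mx Bp (X^T *m Bp))
           (row_mx (Cp *m Y) Cp) Dp
  + col_mx (block_mx 0 Bu 1%:M 0) (row_mx 0 E)
    *m block_mx K L M N
    *m row_mx (block_mx 1%:M 0 0 Cy) (col_mx 0 F).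

Lemma design_blockE (R : realType) p q p' q' mp kp m k
    (A : 'M[R]_(p, q)) (Bp : 'M[R]_(p, mp)) (Cp : 'M[R]_(kp, q)) (Dp : 'M[R]_(kp, mp))
    (Bu : 'M[R]_(p, m)) (E : 'M[R]_(kp, m)) (Cy : 'M[R]_(k, q)) (F : 'M[R]_(k, mp))
    (X : 'M[R]_(p, p')) (Y : 'M[R]_(q, q'))
    (K : 'M[R]_(p', q')) (L : 'M[R]_(p', k)) (M : 'M[R]_(m, q')) (N : 'M[R]_(m, k)) :
  design_block A Bp Cp Dp Bu E Cy F X Y K L M N =
  block_mx
    (block_mx (A *m Y + Bu *m M) (A + Bu *m N *m Cy) K (X^T *m A + L *m Cy))
    (col_mx (Bp + Bu *m N *m F) (X^T *m Bp + L *m F))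
    (row_mx (Cp *m Y + E *m M) (Cp + E *m N *m Cy))
    (Dp + E *m N *m F).
Proof.
rewrite /design_block mul_col_mx mul_col_row.
rewrite mulmx_block mul_row_block.
rewrite !mul0mx !mul1mx !add0r !addr0.
rewrite mulmx_block mul_block_col mul_row_block mul_row_col.
rewrite !mulmx0 !mulmx1 !add0r !addr0.
by rewrite !add_block_mx add_col_mx add_row_mx !add0r.
Qed.

(* The rows of the second channel come in the partition (l, 2l) and its columns in
   the partition (2l, l); [castmx] identifies both with (l, l, l). *)
Definition regroup (R : realType) l q (M : 'M[R]_(l + (l + l), q)) :
  'M[R]_((l + l) + l, q) := castmx (addnA l l l, erefl q) M.

Definition design_system (R : realType) n l mp kp m k
    (G : plant R n l l mp kp m k)
    (X1 Y1 : 'M[R]_n) (X2 Y2 : 'M[R]_(l, l + l))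
    (K : system R n (l + l) (l + l) k m) :
    system R (n + n) ((l + l) + l) ((l + l) + l) mp kp :=
  let K22 := A22 K + upper_part (X2^T *m A22 G *m Y2) in
  let d11 := design_block (A11 G) (B1 G) (C1 G) (D G) (Bu1 G) (E G) (Cy1 G) (F G)
               X1 Y1 (A11 K) (B1 K) (C1 K) (D K) in
  let d12 := design_block (A12 G) (B1 G) (C2 G) (D G) (Bu1 G) (E G) (Cy2 G) (F G)
               X1 Y2 (A12 K) (B1 K) (C2 K) (D K) in
  let d21 := design_block (A21 G) (B2 G) (C1 G) (D G) (Bu2 G) (E G) (Cy1 G) (F G)
               X2 Y1 (A21 K) (B2 K) (C1 K) (D K) in
  let d22 := design_block (A22 G) (B2 G) (C2 G) (D G) (Bu2 G) (E G) (Cy2 G) (F G)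
               X2 Y2 K22 (B2 K) (C2 K) (D K) in
  System (ulsubmx d11) (ulsubmx d12) (ursubmx d11)
         (regroup (ulsubmx d21)) (regroup (ulsubmx d22)) (regroup (ursubmx d22))
         (dlsubmx d11) (dlsubmx d22) (drsubmx d11).

Definition robust_controller (R : realType) n m k mp kp rD sD
    (V : set 'M[R]_(rD, sD))
    (G : plant R n (rD + rD) (sD + sD) mp kp m k) (gamma : R)
    nc lc1 lc2 (K : system R nc (lc1 + lc2) (lc1 + lc2) k m)
    (Dc : 'M[R]_(rD, sD) -> 'M[R]_(lc1 + lc2))
    (X1 : 'M[R]_(n + nc)) (P : 'M[R]_((rD + rD) + (sD + sD) + (lc1 + lc2))) : Prop :=
  [/\ class_K4 V K Dc, posdef X1, full_scalings V Dc P
    & performance_lmi gamma X1 P (closed_loop (lifted_plant G) K)].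

Definition design_conditions (R : realType) n m k mp kp rD sD
    (V : set 'M[R]_(rD, sD))
    (G : plant R n (rD + rD) (sD + sD) mp kp m k) (gamma : R) : Prop :=
  exists X1 Y1 : 'M[R]_n,
  exists P3 Q1 : 'M[R]_((rD + rD) + (sD + sD)),
  exists P Q Rm : 'M[R]_(rD + sD),
  let l := ((rD + rD) + (sD + sD))%N in
  exists K : system R n (l + l) (l + l) k m,
  let P2 := P2_of P Rm in
  let Q2 := Q2_of Q Rm in
  let X2 := row_mx P2 P3 in
  let Y2 := row_mx Q1 Q2 in
  [/\ X1 \is symmetricmx /\ Y1 \is symmetricmx,
      [/\ primal_scalings V P3, dual_scalings V Q1, P \is symmetricmx & Q \is symmetricmx],
      zero_feedthrough K,
      performance_lmi gamma 1%:M 1%:M (design_system (lifted_plant G) X1 Y1 X2 Y2 K)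
      /\ posdef (block_mx Y1 1%:M 1%:M X1)
    & forall M, V M ->
        posdef (P2^T *m Delta_l M *m Q2 + (P2^T *m Delta_l M *m Q2)^T)].

(* Main.v *)
From HB Require Import structures.
Require Import Defs.
From mathcomp Require Import ring lra.

(* A multiplier P of the closed loop and the columns T = (Y2 1; V2 0) with
   P T = (1 X2; 0 U2) turn the analysis inequality into the synthesis inequality by
   congruence.  Taking V2 lower and U2 upper block triangular keeps the transformed
   controller lower block triangular, and the one upper block that the transformation
   creates is P2^T A22 Q2.  The special form of P2 and Q2 is block elimination of the second
   group (r2, s2, l2^c) in P; it makes P2^T Q2 symmetric, so the factorization can be reversed.
   Given synthesis variables, the scheduling function is solved for so that T^T P Delta_lc T has
   skew off-diagonal blocks; its diagonal blocks Delta_l Q1, P2^T Delta_l Q2 and P3 Delta_l have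
   positive definite symmetric parts. *)


Set Implicit Arguments.
Unset Strict Implicit.
Unset Printing Implicit Defensive.
Import Order.TTheory GRing.Theory Num.Theory.
Local Open Scope classical_set_scope.
Local Open Scope ring_scope.

(** The lifting makes [Delta_l M] an involution whose eigenspaces are the graph of [hatDelta M] and
    the first coordinate block. This is why membership in the two scaling classes amounts to
    positivity of the forms of [P3 *m Delta_l M] and [Q1 *m (Delta_l M)^T], the shape needed for the
    diagonal blocks. Degeneracy is the main obstacle, and it differs in the two directions. To build
    a controller, V1 and V2 are taken to be identities, so U1 and U2 must be invertible; the
    diagonal blocks of U2 may be singular and are repaired by rescaling P3 and Q1. To extract
    synthesis variables, the controller order is arbitrary, so the transformations need not be
    injective and congruence alone yields semidefinite conditions; strictness is restored by
    perturbing the controller variables and X1. Finally, the pivot of the block elimination must be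
    invertible although P is indefinite; this comes from the performance inequality and the
    triangular structure. *)

(** * Inner products, definite forms and quantitative bounds *)

Definition dot (R : realType) n (u v : 'cV[R]_n) : R := (u^T *m v) 0 0.

Lemma dotE (R : realType) n (u v : 'cV[R]_n) : dot u v = \sum_i u i 0 * v i 0.
Proof. by rewrite /dot mxE; apply: eq_bigr => i _; rewrite mxE. Qed.

Lemma dotC (R : realType) n (u v : 'cV[R]_n) : dot u v = dot v u.
Proof. by rewrite !dotE; apply: eq_bigr => i _; rewrite mulrC. Qed.

Lemma dotDr (R : realType) n (u v w : 'cV[R]_n) : dot u (v + w) = dot u v + dot u w.
Proof. by rewrite /dot mulmxDr mxE. Qed.

Lemma dotDl (R : realType) n (u v w : 'cV[R]_n) : dot (u + v) w = dot u w + dot v w.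
Proof. by rewrite dotC dotDr !(dotC w). Qed.

Lemma dotZr (R : realType) n a (u v : 'cV[R]_n) : dot u (a *: v) = a * dot u v.
Proof. by rewrite /dot -scalemxAr mxE. Qed.

Lemma dotZl (R : realType) n a (u v : 'cV[R]_n) : dot (a *: u) v = a * dot u v.
Proof. by rewrite dotC dotZr dotC. Qed.

Lemma dotNr (R : realType) n (u v : 'cV[R]_n) : dot u (- v) = - dot u v.
Proof. by rewrite /dot mulmxN mxE. Qed.

Lemma dotNl (R : realType) n (u v : 'cV[R]_n) : dot (- u) v = - dot u v.
Proof. by rewrite dotC dotNr dotC. Qed.

Lemma dot0r (R : realType) n (u : 'cV[R]_n) : dot u 0 = 0.
Proof. by rewrite /dot mulmx0 mxE. Qed.

Lemma dot0l (R : realType) n (u : 'cV[R]_n) : dot 0 u = 0.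
Proof. by rewrite dotC dot0r. Qed.

Lemma dot_mull (R : realType) p q (A : 'M[R]_(p, q)) u v :
  dot (A *m u) v = dot u (A^T *m v).
Proof. by rewrite /dot trmx_mul mulmxA. Qed.

Lemma dot_form (R : realType) n (M : 'M[R]_n) x :
  (x^T *m M *m x) 0 0 = dot x (M *m x).
Proof. by rewrite /dot mulmxA. Qed.

Lemma dot_col (R : realType) p q (a c : 'cV[R]_p) (b d : 'cV[R]_q) :
  dot (col_mx a b) (col_mx c d) = dot a c + dot b d.
Proof. by rewrite /dot tr_col_mx mul_row_col mxE. Qed.

Lemma dot_ge0 (R : realType) n (u : 'cV[R]_n) : 0 <= dot u u.
Proof. by rewrite dotE; apply: sumr_ge0 => i _; rewrite -expr2 sqr_ge0. Qed.

Lemma dot_eq0 (R : realType) n (u : 'cV[R]_n) : dot u u = 0 -> u = 0.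
Proof.
rewrite dotE => /eqP; rewrite psumr_eq0; last by move=> i _; rewrite -expr2 sqr_ge0.
move=> /allP u0; apply/colP => i; rewrite mxE.
by have := u0 i (mem_index_enum i); rewrite mulf_eq0 orbb => /eqP.
Qed.

Lemma dot_gt0 (R : realType) n (u : 'cV[R]_n) : u != 0 -> 0 < dot u u.
Proof.
move=> u0; rewrite lt_neqAle dot_ge0 andbT eq_sym.
by apply: contra u0 => /eqP/dot_eq0 ->.
Qed.

Lemma posdefP (R : realType) n (M : 'M[R]_n) :
  posdef M <-> M^T = M /\ forall x, x != 0 -> 0 < dot x (M *m x).
Proof.
split=> -[sM H]; split; first exact/symmetricmxP.
- by move=> x x0; rewrite -dot_form; apply: H.
- exact/symmetricmxP.
- by move=> x x0; rewrite dot_form; apply: H.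
Qed.

Lemma negdefP (R : realType) n (M : 'M[R]_n) :
  negdef M <-> M^T = M /\ forall x, x != 0 -> dot x (M *m x) < 0.
Proof.
split=> -[sM H]; split; first exact/symmetricmxP.
- by move=> x x0; rewrite -dot_form; apply: H.
- exact/symmetricmxP.
- by move=> x x0; rewrite dot_form; apply: H.
Qed.

Lemma negdefN (R : realType) n (M : 'M[R]_n) : negdef M -> posdef (- M).
Proof.
case/negdefP => sM H; apply/posdefP; split; first by rewrite linearN /= sM.
by move=> x x0; rewrite mulNmx dotNr oppr_gt0 H.
Qed.

Lemma unitmx_inj (R : realType) n (M : 'M[R]_n) :
  (forall x : 'cV[R]_n, M *m x = 0 -> x = 0) -> M \in unitmx.
Proof.
move=> H; rewrite -unitmx_tr -row_free_unit; apply/row_freeP.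
have /eqP: kermx M^T = 0.
  apply/row_matrixP => i; rewrite row0; apply: trmx_inj; rewrite trmx0; apply: H.
  by rewrite -{1}[M]trmxK -trmx_mul -row_mul mulmx_ker row0 trmx0.
by rewrite kermx_eq0 => /row_freeP.
Qed.

Lemma posform_unit (R : realType) n (M : 'M[R]_n) :
  (forall x, x != 0 -> 0 < dot x (M *m x)) -> M \in unitmx.
Proof.
move=> H; apply: unitmx_inj => x Mx; apply/eqP/negPn/negP => /H.
by rewrite Mx dot0r ltxx.
Qed.

Lemma posdef_cauchy (R : realType) n (M : 'M[R]_n) (x y : 'cV[R]_n) :
  posdef M -> dot x (M *m y) ^+ 2 <= dot x (M *m x) * dot y (M *m y).
Proof.
case/posdefP => sM H; have [->|y0] := eqVneq y 0.
  by rewrite mulmx0 !dot0r expr0n mulr0.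
set b := dot y (M *m y); set c := dot x (M *m y); set a := dot x (M *m x).
have b0 : 0 < b by apply: H.
have : 0 <= dot (b *: x - c *: y) (M *m (b *: x - c *: y)).
  have [->|z0] := eqVneq (b *: x - c *: y) 0; first by rewrite dot0l.
  exact/ltW/H.
have -> : dot (b *: x - c *: y) (M *m (b *: x - c *: y)) = b * (a * b - c ^+ 2).
  rewrite !(mulmxDr, mulmxN, =^~ scalemxAr, dotDl, dotDr, dotNr, dotNl, dotZl, dotZr).
  have -> : dot y (M *m x) = c by rewrite /c dotC dot_mull sM.
  rewrite -/a -/b -/c; ring.
by rewrite pmulr_rge0// subr_ge0.
Qed.

Lemma posdef1 (R : realType) n : posdef (1%:M : 'M[R]_n).
Proof. by apply/posdefP; rewrite trmx1; split=> // x; rewrite mul1mx; apply: dot_gt0. Qed.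

Lemma dot_cauchy (R : realType) n (x y : 'cV[R]_n) :
  dot x y ^+ 2 <= dot x x * dot y y.
Proof. by have := posdef_cauchy x y (posdef1 R n); rewrite !mul1mx. Qed.

(** Cauchy-Schwarz row by row; the constant is the squared Frobenius norm. *)
Lemma mulmx_bounded (R : realType) p q (A : 'M[R]_(p, q)) :
  exists2 K : R, 0 <= K & forall u, dot (A *m u) (A *m u) <= K * dot u u.
Proof.
pose K := \sum_i dot (row i A)^T (row i A)^T.
exists K; first by apply: sumr_ge0 => i _; apply: dot_ge0.
move=> u; rewrite dotE mulr_suml; apply: ler_sum => i _.
have -> : (A *m u) i 0 = dot (row i A)^T u.
  by rewrite dotE mxE; apply: eq_bigr => j _; rewrite !mxE.
by rewrite -expr2 dot_cauchy.
Qed.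

(** Compactness of the sphere is avoided: Cauchy-Schwarz for the form of [M], applied to x and M^-1
    x, gives |x|^4 <= (x . M x)(x . M^-1 x), and the last factor is at most (K + 1)/2 |x|^2 when K
    bounds M^-1. *)
Lemma posdef_coercive (R : realType) n (M : 'M[R]_n) :
  posdef M -> exists2 c : R, 0 < c & forall x, c * dot x x <= dot x (M *m x).
Proof.
move=> pM; have /posdefP[sM H] := pM; have uM := posform_unit H.
have [K K0 HK] := mulmx_bounded (invmx M).
exists (2 / (K + 1)) => [|x]; first by rewrite divr_gt0// ltr_wpDl.
have [->|x0] := eqVneq x 0; first by rewrite mulmx0 !dot0r mulr0.
have := posdef_cauchy x (invmx M *m x) pM; rewrite mulKVmx//.
have xx := dot_gt0 x0; set a := dot x x in xx *; set b := dot x (M *m x).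
set e := dot _ x => h.
have : e <= (K + 1) / 2 * a.
  have := dot_ge0 (invmx M *m x - x); have := HK x.
  rewrite !(dotDl, dotDr, dotNr, dotNl) -/e (dotC x) -/e -/a; lra.
have b0 : 0 < b by apply: H.
move=> h2; have : a <= b * ((K + 1) / 2).
  rewrite -(ler_pM2r xx) -expr2 (le_trans h)// -mulrA ler_pM2l//.
rewrite mulrAC ler_pdivrMr ?ltr_wpDl//; lra.
Qed.

(** Young's inequality, from |S^T u - v|^2 >= 0. The coefficient 1 of |v|^2 is what the absorption
    argument in [design_strict] relies on. *)
Lemma cross_bounded (R : realType) p q (S : 'M[R]_(p, q)) :
  exists2 K : R, 0 <= K &
    forall u v, 2 * dot u (S *m v) <= K * dot u u + dot v v.
Proof.
have [K K0 HK] := mulmx_bounded S^T; exists K => // u v.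
have := dot_ge0 (S^T *m u - v); have := HK u.
rewrite !(dotDl, dotDr, dotNr, dotNl) (dotC v) (dot_mull _ u v) trmxK.
lra.
Qed.

(** * Affine matrix functions and openness of definiteness along lines *)

(** The domain is kept general for two uses: [R^o] for one-parameter perturbations of an inequality,
    and the space of the uncertainties for the scheduling function. *)
Definition affine (R : realType) (W : lmodType R) p q (f : W -> 'M[R]_(p, q)) : Prop :=
  exists (L : {linear W -> 'M[R]_(p, q)}) (C : 'M[R]_(p, q)), forall x, f x = L x + C.

Lemma affine_linear (R : realType) (W : lmodType R) p q (L : {linear W -> 'M[R]_(p, q)}) :
  affine L.
Proof. by exists L, 0 => x; rewrite addr0. Qed.

Lemma affine_cst (R : realType) (W : lmodType R) p q (C : 'M[R]_(p, q)) :
  affine (fun _ : W => C).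
Proof. by exists (\0%R : {linear W -> 'M[R]_(p, q)}), C => x; rewrite add0r. Qed.

Lemma affine_comp (R : realType) (W : lmodType R) p q p' q' (f : W -> 'M[R]_(p, q))
    (L : {linear 'M[R]_(p, q) -> 'M[R]_(p', q')}) :
  affine f -> affine (fun x => L (f x)).
Proof.
move=> [Lf [C Hf]]; exists (L \o Lf : {linear W -> 'M[R]_(p', q')}), (L C) => x.
by rewrite Hf linearD.
Qed.

Lemma affineD (R : realType) (W : lmodType R) p q (f g : W -> 'M[R]_(p, q)) :
  affine f -> affine g -> affine (fun x => f x + g x).
Proof.
move=> [L [C Hf]] [L' [C' Hg]].
exists (L \+ L' : {linear W -> 'M[R]_(p, q)}), (C + C') => x.
by rewrite Hf Hg addrACA.
Qed.

Lemma affineN (R : realType) (W : lmodType R) p q (f : W -> 'M[R]_(p, q)) :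
  affine f -> affine (fun x => - f x).
Proof. exact: (@affine_comp _ _ _ _ _ _ f -%R). Qed.

Lemma affineZ (R : realType) (W : lmodType R) p q a (f : W -> 'M[R]_(p, q)) :
  affine f -> affine (fun x => a *: f x).
Proof. exact: (@affine_comp _ _ _ _ _ _ f ( *:%R a)). Qed.

Lemma affine_mull (R : realType) (W : lmodType R) p q r (A : 'M[R]_(r, p))
    (f : W -> 'M[R]_(p, q)) :
  affine f -> affine (fun x => A *m f x).
Proof. exact: (@affine_comp _ _ _ _ _ _ f (mulmx A)). Qed.

Lemma affine_mulr (R : realType) (W : lmodType R) p q r (A : 'M[R]_(q, r))
    (f : W -> 'M[R]_(p, q)) :
  affine f -> affine (fun x => f x *m A).
Proof. exact: (@affine_comp _ _ _ _ _ _ f (mulmxr A)). Qed.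

Lemma affine_tr (R : realType) (W : lmodType R) p q (f : W -> 'M[R]_(p, q)) :
  affine f -> affine (fun x => (f x)^T).
Proof. exact: (@affine_comp _ _ _ _ _ _ f trmx). Qed.

Lemma affine_cast (R : realType) (W : lmodType R) p q p' q' (e : (p = p') * (q = q'))
    (f : W -> 'M[R]_(p, q)) :
  affine f -> affine (fun x => castmx e (f x)).
Proof.
case: e => e1 e2; case: _ / e1; case: _ / e2 => -[L [C Hf]].
by exists L, C => x; rewrite castmx_id.
Qed.

Lemma affine_row (R : realType) (W : lmodType R) p q q' (f : W -> 'M[R]_(p, q))
    (g : W -> 'M[R]_(p, q')) :
  affine f -> affine g -> affine (fun x => row_mx (f x) (g x)).
Proof.
move=> /(affine_mulr (row_mx 1%:M 0)) Hf /(affine_mulr (row_mx 0 1%:M)) Hg.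
have [L [C H]] := affineD (Hf q') (Hg q); exists L, C => x; rewrite -H !mul_mx_row add_row_mx.
by rewrite !mulmx1 !mulmx0 addr0 add0r.
Qed.

Lemma affine_col (R : realType) (W : lmodType R) p p' q (f : W -> 'M[R]_(p, q))
    (g : W -> 'M[R]_(p', q)) :
  affine f -> affine g -> affine (fun x => col_mx (f x) (g x)).
Proof.
move=> /(affine_mull (col_mx 1%:M 0)) Hf /(affine_mull (col_mx 0 1%:M)) Hg.
have [L [C H]] := affineD (Hf p') (Hg p); exists L, C => x; rewrite -H !mul_col_mx add_col_mx.
by rewrite !mul1mx !mul0mx addr0 add0r.
Qed.

Lemma affine_block (R : realType) (W : lmodType R) p p' q q'
    (f : W -> 'M[R]_(p, q)) (g : W -> 'M[R]_(p, q'))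
    (h : W -> 'M[R]_(p', q)) (i : W -> 'M[R]_(p', q')) :
  affine f -> affine g -> affine h -> affine i ->
  affine (fun x => block_mx (f x) (g x) (h x) (i x)).
Proof. by move=> Hf Hg Hh Hi; apply: affine_col; apply: affine_row. Qed.

Lemma affine_lineE (R : realType) p q (f : R^o -> 'M[R]_(p, q)) :
  affine f -> exists B, forall t, f t = f 0 + t *: B.
Proof.
move=> [L [C Hf]]; exists (L 1) => t.
by rewrite !Hf linear0 add0r addrC -linearZ /= /GRing.scale /= mulr1.
Qed.

Lemma negdef_open (R : realType) p q (Pi : 'M[R]_p) (f : R^o -> 'M[R]_(p, q)) :
  Pi^T = Pi -> affine f -> negdef ((f 0)^T *m Pi *m f 0) ->
  exists2 e : R, 0 < e & forall t : R, 0 < t <= e -> negdef ((f t)^T *m Pi *m f t).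
Proof.
move=> sPi /affine_lineE[B Hf] N0; set A := f 0 in Hf N0.
have [c c0 Hc] := posdef_coercive (negdefN N0).
have [K K0 HK] := cross_bounded (A^T *m Pi *m B).
have [K' K'0 HK'] := cross_bounded (B^T *m Pi *m B).
have [k kE] : exists k, k = K + 1 + (K' + 1) / 2 by eexists.
have k0 : 0 < k by lra.
(* This bound gives both t <= 1, so that t^2 is dominated by t, and t k < c, so that the
   perturbation, at most t k |x|^2, stays below the margin c |x|^2. *)
exists (c / (c + k)) => [|t /andP[t0 te]]; first by rewrite divr_gt0// addr_gt0.
apply/negdefP; split; first by rewrite !trmx_mul trmxK sPi mulmxA.
move=> x x0; rewrite Hf.
have := HK x x; have := HK' x x; have := Hc x.
rewrite mulNmx dotNr -!mulmxA !(mulmxDl, mulmxDr, linearD, linearZ,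
  =^~ scalemxAl, =^~ scalemxAr, dotDr, dotZr) /=.
rewrite !(mulmxDl, mulmxDr, =^~ scalemxAl, =^~ scalemxAr, dotDr, dotZr).
have -> : dot x (B^T *m (Pi *m (A *m x))) = dot x (A^T *m (Pi *m (B *m x))).
  by rewrite -!dot_mull dotC dot_mull sPi.
set a := dot _ (A^T *m (Pi *m (A *m x))); set b := dot _ (A^T *m (Pi *m (B *m x))).
set d := dot _ (B^T *m (Pi *m (B *m x))).
have := dot_gt0 x0; set y := dot x x => y0 ha hd hb.
have t1 : t <= 1 by apply: (le_trans te); rewrite ler_pdivrMr ?addr_gt0//; lra.
have tk : t * k < c.
  apply: (@le_lt_trans _ _ (c / (c + k) * k)); first by rewrite ler_pM2r.
  rewrite mulrAC ltr_pdivrMr ?addr_gt0//; nra.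
have hb' : 2 * b <= (K + 1) * y by lra.
have hd' : d <= (K' + 1) / 2 * y by lra.
have : t * (2 * b) <= t * ((K + 1) * y) by rewrite ler_pM2l.
have : t * t * d <= t * ((K' + 1) / 2 * y).
  apply: (@le_trans _ _ (t * t * ((K' + 1) / 2 * y))); first by rewrite ler_pM2l// mulr_gt0.
  rewrite ler_pM2r; last by rewrite mulr_gt0//; lra.
  by rewrite -{3}[t]mulr1 ler_pM2l.
have : t * k * y < c * y by rewrite ltr_pM2r.
rewrite kE; lra.
Qed.

(** * The performance inequality as a quadratic form, and its congruence transformation *)

Definition perf_form (R : realType) nx nw mp kp (gamma : R) (X : 'M[R]_nx) (P : 'M[R]_nw)
    (S : system R nx nw nw mp kp) x w d : R :=
  2 * dot x (X *m (A11 S *m x + A12 S *m w + B1 S *m d))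
  + 2 * dot w (P *m (A21 S *m x + A22 S *m w + B2 S *m d))
  - gamma * dot d d
  + dot (C1 S *m x + C2 S *m w + D S *m d) (C1 S *m x + C2 S *m w + D S *m d).

Lemma middle_sym (R : realType) nx nw mp kp (gamma : R) (X : 'M[R]_nx) (P : 'M[R]_nw) :
  X^T = X -> P^T = P -> (middle mp kp gamma X P)^T = middle mp kp gamma X P.
Proof.
move=> sX sP; rewrite /middle /diag2 /antidiag2 !tr_block_mx !trmx0 sX sP trmx1.
by rewrite linearN /= tr_scalar_mx.
Qed.

Lemma perf_formE (R : realType) nx nw mp kp (gamma : R) (X : 'M[R]_nx) (P : 'M[R]_nw)
    (S : system R nx nw nw mp kp) x w d :
  X^T = X -> P^T = P ->
  dot (col_mx (col_mx x w) d)
    ((outer_factor S)^T *m middle mp kp gamma X P *m outer_factor S *m col_mx (col_mx x w) d)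
  = perf_form gamma X P S x w d.
Proof.
move=> sX sP; rewrite -!mulmxA -dot_mull.
have -> : outer_factor S *m col_mx (col_mx x w) d =
  col_mx (col_mx (col_mx x (A11 S *m x + A12 S *m w + B1 S *m d))
                 (col_mx w (A21 S *m x + A22 S *m w + B2 S *m d)))
         (col_mx d (C1 S *m x + C2 S *m w + D S *m d)).
  by rewrite /outer_factor !(mul_col_mx, mul_row_col, mul1mx, mul0mx, addr0, add0r).
rewrite /middle /diag2 /antidiag2 !(mul_block_col, mul0mx, add0r, addr0, mul1mx).
rewrite !dot_col mulNmx mul_scalar_mx dotNr dotZr /perf_form.
rewrite [dot _ (X *m x)]dotC (dot_mull X) sX [dot _ (P *m w)]dotC (dot_mull P) sP.
ring.
Qed.

Lemma performance_lmiP (R : realType) nx nw mp kp (gamma : R) (X : 'M[R]_nx) (P : 'M[R]_nw)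
    (S : system R nx nw nw mp kp) :
  X^T = X -> P^T = P ->
  performance_lmi gamma X P S <->
  forall x w d, col_mx (col_mx x w) d != 0 -> perf_form gamma X P S x w d < 0.
Proof.
move=> sX sP; split=> [/negdefP[_ H] x w d /H|H]; first by rewrite perf_formE.
apply/negdefP; split; first by rewrite !trmx_mul trmxK middle_sym// mulmxA.
move=> v; rewrite -[v]vsubmxK -[usubmx v]vsubmxK => v0.
by rewrite perf_formE//; apply: H.
Qed.

Lemma performance_lmi_open (R : realType) nx nw mp kp (gamma : R) (X : 'M[R]_nx)
    (P : 'M[R]_nw) (S : R^o -> system R nx nw nw mp kp) :
  X^T = X -> P^T = P ->
  affine (fun t => A11 (S t)) -> affine (fun t => A12 (S t)) -> affine (fun t => B1 (S t)) ->
  affine (fun t => A21 (S t)) -> affine (fun t => A22 (S t)) -> affine (fun t => B2 (S t)) ->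
  affine (fun t => C1 (S t)) -> affine (fun t => C2 (S t)) -> affine (fun t => D (S t)) ->
  performance_lmi gamma X P (S 0) ->
  exists2 e : R, 0 < e & forall t : R, 0 < t <= e -> performance_lmi gamma X P (S t).
Proof.
move=> sX sP ? ? ? ? ? ? ? ? ?; apply: (@negdef_open _ _ _ _ (fun t => outer_factor (S t))).
  exact: middle_sym.
by rewrite /outer_factor; do ?[exact: affine_cst|assumption|apply: affine_col|apply: affine_row].
Qed.

(** The multipliers are absorbed into the new system matrices, which is why the synthesis inequality
    has identity multipliers. The identity is pointwise and asks nothing of [T1] and [T2], so it
    serves both directions, including singular transformations. *)
Lemma perf_form_congr (R : realType) nx nw nx' nw' mp kp (gamma : R)
    (X : 'M[R]_nx) (P : 'M[R]_nw) (T1 : 'M[R]_(nx, nx')) (T2 : 'M[R]_(nw, nw'))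
    (S : system R nx nw nw mp kp) (S' : system R nx' nw' nw' mp kp) x w d :
  A11 S' = T1^T *m X *m A11 S *m T1 -> A12 S' = T1^T *m X *m A12 S *m T2 ->
  B1 S' = T1^T *m X *m B1 S ->
  A21 S' = T2^T *m P *m A21 S *m T1 -> A22 S' = T2^T *m P *m A22 S *m T2 ->
  B2 S' = T2^T *m P *m B2 S ->
  C1 S' = C1 S *m T1 -> C2 S' = C2 S *m T2 -> D S' = D S ->
  perf_form gamma 1%:M 1%:M S' x w d = perf_form gamma X P S (T1 *m x) (T2 *m w) d.
Proof.
rewrite /perf_form => -> -> -> -> -> -> -> -> ->; rewrite !mul1mx.
by rewrite (dot_mull T1) (dot_mull T2) !mulmxA !(mulmxDr, mulmxA).
Qed.

Lemma closed_loopE (R : realType) n w z mp kp m k nc wc zc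
    (G : plant R n w z mp kp m k) (K : system R nc wc zc k m) :
  D K = 0 ->
  closed_loop G K =
  System (block_mx (A11 G) (Bu1 G *m C1 K) (B1 K *m Cy1 G) (A11 K))
         (block_mx (A12 G) (Bu1 G *m C2 K) (B1 K *m Cy2 G) (A12 K))
         (col_mx (B1 G) (B1 K *m F G))
         (block_mx (A21 G) (Bu2 G *m C1 K) (B2 K *m Cy1 G) (A21 K))
         (block_mx (A22 G) (Bu2 G *m C2 K) (B2 K *m Cy2 G) (A22 K))
         (col_mx (B2 G) (B2 K *m F G))
         (row_mx (C1 G) (E G *m C1 K)) (row_mx (C2 G) (E G *m C2 K)) (D G).
Proof.
move=> DK; rewrite /closed_loop !closed_loop_blockE DK !(mulmx0, mul0mx, addr0).
by rewrite !(block_mxKul, block_mxKur, block_mxKdl, block_mxKdr).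
Qed.

Lemma design_systemE (R : realType) n l mp kp m k (G : plant R n l l mp kp m k)
    (X1 Y1 : 'M[R]_n) (X2 Y2 : 'M[R]_(l, l + l)) (K : system R n (l + l) (l + l) k m) :
  D K = 0 ->
  design_system G X1 Y1 X2 Y2 K =
  System
    (block_mx (A11 G *m Y1 + Bu1 G *m C1 K) (A11 G) (A11 K) (X1^T *m A11 G + B1 K *m Cy1 G))
    (block_mx (A12 G *m Y2 + Bu1 G *m C2 K) (A12 G) (A12 K) (X1^T *m A12 G + B1 K *m Cy2 G))
    (col_mx (B1 G) (X1^T *m B1 G + B1 K *m F G))
    (regroup (block_mx (A21 G *m Y1 + Bu2 G *m C1 K) (A21 G)
                       (A21 K) (X2^T *m A21 G + B2 K *m Cy1 G)))
    (regroup (block_mx (A22 G *m Y2 + Bu2 G *m C2 K) (A22 G)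
                       (A22 K + upper_part (X2^T *m A22 G *m Y2))
                       (X2^T *m A22 G + B2 K *m Cy2 G)))
    (regroup (col_mx (B2 G) (X2^T *m B2 G + B2 K *m F G)))
    (row_mx (C1 G *m Y1 + E G *m C1 K) (C1 G)) (row_mx (C2 G *m Y2 + E G *m C2 K) (C2 G))
    (D G).
Proof.
move=> DK; rewrite /design_system !design_blockE DK !(mulmx0, mul0mx, addr0).
by rewrite !(block_mxKul, block_mxKur, block_mxKdl, block_mxKdr).
Qed.

Lemma regroup_mul (R : realType) l p q (M : 'M[R]_(l + (l + l), p)) (N : 'M[R]_(p, q)) :
  regroup M *m N = regroup (M *m N).
Proof.
by rewrite /regroup; move: (addnA l l l) M => e; case: _ / e => M; rewrite !castmx_id.
Qed.

Lemma regroup_col (R : realType) l q (M N L : 'M[R]_(l, q)) :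
  regroup (col_mx M (col_mx N L)) = col_mx (col_mx M N) L.
Proof. by rewrite col_mxA /regroup castmx_comp castmx_id. Qed.

(** All products of multiplier and controller unknowns gather in the lower left block; renaming that
    block as a new variable linearizes the problem. *)
Lemma closed_to_design_block (R : realType) p q p' q' pc qc m k
    (A : 'M[R]_(p, q)) (Bu : 'M[R]_(p, m)) (Cy : 'M[R]_(k, q))
    (Ac : 'M[R]_(pc, qc)) (Bc : 'M[R]_(pc, k)) (Cc : 'M[R]_(m, qc))
    (X : 'M[R]_(p, p')) (U : 'M[R]_(pc, p')) (Y : 'M[R]_(q, q')) (V : 'M[R]_(qc, q')) :
  (block_mx 1%:M X 0 U)^T *m block_mx A (Bu *m Cc) (Bc *m Cy) Ac *m block_mx Y 1%:M V 0 =
  block_mx (A *m Y + Bu *m (Cc *m V)) A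
    (X^T *m A *m Y + X^T *m Bu *m (Cc *m V) + U^T *m Bc *m (Cy *m Y) + U^T *m Ac *m V)
    (X^T *m A + U^T *m Bc *m Cy).
Proof.
rewrite tr_block_mx trmx1 trmx0 !mulmx_block !(mul1mx, mulmx1, mul0mx, mulmx0, addr0).
rewrite !mulmxDl !mulmxA; congr block_mx.
by rewrite -!addrA; congr (_ + _); rewrite [RHS]addrCA.
Qed.

(** The equations for [Kd] are the nonlinear change of controller variables. Only [A22] carries a
    correction: [A22 Kd] has to stay lower block triangular, so the upper block of the right-hand
    side must come from [upper_part]. *)
Lemma perf_form_design (R : realType) n l mp kp m k nc lc (gamma : R)
    (G : plant R n l l mp kp m k) (K : system R nc lc lc k m)
    (Kd : system R n (l + l) (l + l) k m)
    (X : 'M[R]_(n + nc)) (P : 'M[R]_(l + lc))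
    (X1 Y1 : 'M[R]_n) (U1 V1 : 'M[R]_(nc, n))
    (X2 Y2 : 'M[R]_(l, l + l)) (U2 V2 : 'M[R]_(lc, l + l)) x w d :
  let T1 := block_mx Y1 1%:M V1 0 : 'M[R]_(n + nc, n + n) in
  let T2 := block_mx Y2 1%:M V2 0 : 'M[R]_(l + lc, (l + l) + l) in
  T1^T *m X = (block_mx 1%:M X1 0 U1)^T -> T2^T *m P = regroup (block_mx 1%:M X2 0 U2)^T ->
  D K = 0 -> D Kd = 0 ->
  B1 Kd = U1^T *m B1 K -> B2 Kd = U2^T *m B2 K ->
  C1 Kd = C1 K *m V1 -> C2 Kd = C2 K *m V2 ->
  A11 Kd = X1^T *m A11 G *m Y1 + X1^T *m Bu1 G *m (C1 K *m V1)
           + U1^T *m B1 K *m (Cy1 G *m Y1) + U1^T *m A11 K *m V1 ->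
  A12 Kd = X1^T *m A12 G *m Y2 + X1^T *m Bu1 G *m (C2 K *m V2)
           + U1^T *m B1 K *m (Cy2 G *m Y2) + U1^T *m A12 K *m V2 ->
  A21 Kd = X2^T *m A21 G *m Y1 + X2^T *m Bu2 G *m (C1 K *m V1)
           + U2^T *m B2 K *m (Cy1 G *m Y1) + U2^T *m A21 K *m V1 ->
  A22 Kd + upper_part (X2^T *m A22 G *m Y2) =
           X2^T *m A22 G *m Y2 + X2^T *m Bu2 G *m (C2 K *m V2)
           + U2^T *m B2 K *m (Cy2 G *m Y2) + U2^T *m A22 K *m V2 ->
  perf_form gamma 1%:M 1%:M (design_system G X1 Y1 X2 Y2 Kd) x w d =
  perf_form gamma X P (closed_loop G K) (T1 *m x) (T2 *m w) d.
Proof.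
move=> T1 T2 HX HP DK DKd B1E B2E C1E C2E A11E A12E A21E A22E.
apply: perf_form_congr; rewrite design_systemE// closed_loopE//=.
- by rewrite HX closed_to_design_block B1E C1E A11E.
- by rewrite HX closed_to_design_block B1E C2E A12E.
- by rewrite HX tr_block_mx trmx1 trmx0 mul_block_col B1E !mul1mx !mul0mx addr0 !mulmxA.
- by rewrite HP !regroup_mul closed_to_design_block B2E C1E A21E.
- by rewrite HP !regroup_mul closed_to_design_block A22E B2E C2E.
- rewrite HP !regroup_mul tr_block_mx trmx1 trmx0 mul_block_col B2E !mul1mx !mul0mx.
  by rewrite addr0 !mulmxA.
- by rewrite mul_row_block mulmx1 mulmx0 addr0 C1E !mulmxA.
- by rewrite mul_row_block mulmx1 mulmx0 addr0 C2E !mulmxA.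
Qed.

(** * Scaling classes as positivity of forms with the lifted uncertainty *)

Lemma dot_sum_diff (R : realType) n (P : 'M[R]_n) u v :
  P^T = P -> dot (u + v) (P *m (u - v)) = dot u (P *m u) - dot v (P *m v).
Proof.
move=> sP; rewrite !(mulmxDr, mulmxN, dotDl, dotDr, dotNr).
rewrite [dot v (P *m u)]dotC (dot_mull P) sP; ring.
Qed.

Lemma congr_sym (R : realType) p q (P : 'M[R]_p) (T : 'M[R]_(p, q)) :
  P^T = P -> (T^T *m P *m T)^T = T^T *m P *m T.
Proof. by move=> sP; rewrite !trmx_mul trmxK sP mulmxA. Qed.

Lemma dot_congr (R : realType) p q (P : 'M[R]_p) (T : 'M[R]_(p, q)) x :
  dot x (T^T *m P *m T *m x) = dot (T *m x) (P *m (T *m x)).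
Proof. by rewrite (dot_mull T) !mulmxA. Qed.

Lemma Delta_l_col (R : realType) rD sD (M : 'M[R]_(rD, sD)) q (a : 'M[R]_(_, q)) b :
  Delta_l M *m col_mx a b = col_mx (2 *: (hatDelta M *m b) - a) b.
Proof.
by rewrite /Delta_l mul_block_col mulNmx !mul1mx mul0mx add0r -scalemxAl addrC.
Qed.

Lemma Delta_lT_col (R : realType) rD sD (M : 'M[R]_(rD, sD)) q (a : 'M[R]_(_, q)) b :
  (Delta_l M)^T *m col_mx a b = col_mx (- a) (2 *: ((hatDelta M)^T *m a) + b).
Proof.
rewrite /Delta_l tr_block_mx mul_block_col trmx0 mul0mx addr0 trmx1 mul1mx.
by rewrite linearN /= trmx1 mulNmx mul1mx linearZ /= -scalemxAl.
Qed.

(** [Delta_l M] fixes the range of [T] and negates the range of [T0], so the form is that of u + v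
    against u - v and the cross terms cancel. *)
Lemma primal_splitE (R : realType) rD sD (P : 'M[R]_((rD + rD) + (sD + sD)))
    (M : 'M[R]_(rD, sD)) b c :
  P^T = P ->
  let T := col_mx (hatDelta M) 1%:M in let T0 := col_mx 1%:M 0 in
  dot (T *m b + T0 *m c) (P *m (Delta_l M *m (T *m b + T0 *m c))) =
  dot (T *m b) (P *m (T *m b)) - dot (T0 *m c) (P *m (T0 *m c)).
Proof.
move=> sP T T0; rewrite -dot_sum_diff//; congr (dot _ (P *m _)).
rewrite /T /T0 (mul_col_mx (hatDelta M)) (mul_col_mx 1%:M 0) !mul1mx mul0mx !add_col_mx addr0.
rewrite Delta_l_col opp_col_mx add_col_mx oppr0 addr0; congr col_mx.
by rewrite opprD scaler_nat mulr2n addrA addrK.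
Qed.

(** Here the transpose fixes the range of [T0] and negates that of [T], hence the exchanged
    signs. *)
Lemma dual_splitE (R : realType) rD sD (P : 'M[R]_((rD + rD) + (sD + sD)))
    (M : 'M[R]_(rD, sD)) b c :
  P^T = P ->
  let T := col_mx 1%:M (- (hatDelta M)^T) in let T0 := col_mx 0 1%:M in
  dot (T0 *m c + T *m b) (P *m ((Delta_l M)^T *m (T0 *m c + T *m b))) =
  dot (T0 *m c) (P *m (T0 *m c)) - dot (T *m b) (P *m (T *m b)).
Proof.
move=> sP T T0; rewrite -dot_sum_diff//; congr (dot _ (P *m _)).
rewrite /T /T0 (mul_col_mx 0 1%:M) (mul_col_mx 1%:M) !mul1mx mul0mx !add_col_mx add0r.
rewrite Delta_lT_col opp_col_mx add_col_mx add0r; congr col_mx.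
by rewrite mulNmx opprK scaler_nat mulr2n addrCA addrK.
Qed.

Lemma primal_scalings_form (R : realType) rD sD (V : set 'M[R]_(rD, sD)) P M x :
  primal_scalings V P -> V M -> x != 0 -> 0 < dot x (P *m (Delta_l M *m x)).
Proof.
case=> /symmetricmxP sP /negdefP[_ HN] /(_ M) HP /HP/posdefP[_ {}HP].
pose b := dsubmx x; pose c := usubmx x - hatDelta M *m b.
have -> : x = col_mx (hatDelta M) 1%:M *m b + col_mx 1%:M 0 *m c.
  by rewrite (mul_col_mx (hatDelta M)) (mul_col_mx 1%:M 0) !mul1mx mul0mx add_col_mx addr0
    addrC subrK vsubmxK.
move=> x0; rewrite primal_splitE// subr_gt0 -!dot_congr.
have [b0|/HP] := eqVneq b 0; have [c0|/HN] := eqVneq c 0.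
- by move: x0; rewrite b0 c0 !mulmx0 addr0 eqxx.
- by rewrite b0 mulmx0 dot0l.
- by rewrite c0 mulmx0 dot0l.
- exact: lt_trans.
Qed.

Lemma primal_scalingsI (R : realType) rD sD (V : set 'M[R]_(rD, sD)) P :
  P^T = P -> V 0 ->
  (forall M x, V M -> x != 0 -> 0 < dot x (P *m (Delta_l M *m x))) ->
  primal_scalings V P.
Proof.
move=> sP V0 H; split; first exact/symmetricmxP.
- apply/negdefP; split; first exact: congr_sym.
  move=> c c0; rewrite dot_congr -oppr_gt0.
  (* The negativity condition does not involve the uncertainty, so it can be read off at the point 0
     of [V]. *)
  have /= := primal_splitE 0 0 c sP; rewrite mulmx0 add0r dot0l sub0r => <-; apply: H => //.
  by rewrite mul_col_mx mul1mx mul0mx col_mx_eq0 negb_and c0.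
move=> M VM; apply/posdefP; split; first exact: congr_sym.
move=> b b0; rewrite dot_congr.
have /= := primal_splitE M b 0 sP; rewrite mulmx0 addr0 dot0l subr0 => <-; apply: H => //.
by rewrite mul_col_mx mul1mx col_mx_eq0 negb_and b0 orbT.
Qed.

Lemma dual_scalings_form (R : realType) rD sD (V : set 'M[R]_(rD, sD)) P M x :
  dual_scalings V P -> V M -> x != 0 -> 0 < dot x (P *m ((Delta_l M)^T *m x)).
Proof.
case=> /symmetricmxP sP /posdefP[_ HP] /(_ M) HN /HN/negdefP[_ {}HN].
pose b := usubmx x; pose c := dsubmx x + (hatDelta M)^T *m b.
have -> : x = col_mx 0 1%:M *m c + col_mx 1%:M (- (hatDelta M)^T) *m b.
  by rewrite (mul_col_mx 0) (mul_col_mx 1%:M) !mul1mx mul0mx add_col_mx add0r mulNmx addrK vsubmxK.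
move=> x0; rewrite dual_splitE// subr_gt0 -!dot_congr.
have [b0|/HN] := eqVneq b 0; have [c0|/HP] := eqVneq c 0.
- by move: x0; rewrite b0 c0 !mulmx0 addr0 eqxx.
- by rewrite b0 mulmx0 dot0l.
- by rewrite c0 mulmx0 dot0l.
- by move=> p n; apply: lt_trans n p.
Qed.

Lemma dual_scalingsI (R : realType) rD sD (V : set 'M[R]_(rD, sD)) P :
  P^T = P -> V 0 ->
  (forall M x, V M -> x != 0 -> 0 < dot x (P *m ((Delta_l M)^T *m x))) ->
  dual_scalings V P.
Proof.
move=> sP V0 H; split; first exact/symmetricmxP.
- apply/posdefP; split; first exact: congr_sym.
  move=> c c0; rewrite dot_congr.
  have /= := dual_splitE 0 0 c sP; rewrite mulmx0 addr0 dot0l subr0 => <-; apply: H => //.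
  by rewrite mul_col_mx mul1mx mul0mx col_mx_eq0 negb_and c0 orbT.
move=> M VM; apply/negdefP; split; first exact: congr_sym.
move=> b b0; rewrite dot_congr -oppr_gt0.
have /= := dual_splitE M b 0 sP; rewrite mulmx0 add0r dot0l sub0r => <-; apply: H => //.
by rewrite mul_col_mx mul1mx col_mx_eq0 negb_and b0.
Qed.

Lemma full_scalingsP (R : realType) rD sD (V : set 'M[R]_(rD, sD)) lc
    (Dc : 'M[R]_(rD, sD) -> 'M[R]_lc) P :
  full_scalings V Dc P <->
  P^T = P /\
  forall M x, V M -> x != 0 -> 0 < dot x (P *m (diag2 (Delta_l M) (Dc M) *m x)).
Proof.
have formE M x : P^T = P -> let T := col_mx (diag2 (Delta_l M) (Dc M)) 1%:M in
    dot x (T^T *m antidiag2 P *m T *m x) = 2 * dot x (P *m (diag2 (Delta_l M) (Dc M) *m x)).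
  move=> sP T; rewrite dot_congr /T /antidiag2 mul_col_mx mul1mx mul_block_col !mul0mx.
  by rewrite add0r addr0 dot_col [dot (_ *m _) _]dotC dot_mull sP mulr_natl mulr2n.
split=> [[/symmetricmxP sP H]|[sP H]]; split=> //.
- move=> M x VM x0; have /posdefP[_ /(_ x x0)] := H M VM.
  by rewrite formE// pmulr_rgt0.
- exact/symmetricmxP.
move=> M VM; apply/posdefP; split=> [|x x0]; last by rewrite formE// pmulr_rgt0// H.
by apply: congr_sym; rewrite /antidiag2 tr_block_mx !trmx0 sP.
Qed.

Lemma symm_part_posdefP (R : realType) n (M : 'M[R]_n) :
  posdef (M + M^T) <-> forall x, x != 0 -> 0 < dot x (M *m x).
Proof.
have formE x : dot x ((M + M^T) *m x) = 2 * dot x (M *m x).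
  by rewrite mulmxDl dotDr -[dot x (M^T *m x)]dot_mull dotC mulr_natl mulr2n.
split=> [/posdefP[_ H] x /H|H]; first by rewrite formE pmulr_rgt0.
apply/posdefP; split=> [|x x0]; last by rewrite formE pmulr_rgt0// H.
by rewrite linearD /= trmxK addrC.
Qed.

(** * Coordinate groups and the structured factors P2 and Q2 *)

(** The order (r1, r2, s1, s2) interleaves the groups (r1, s1) and (r2, s2). Selecting a group by an
    isometry avoids permuting coordinates and exposes the triangular structure. *)
Definition sel1 (R : realType) r1 r2 s1 s2 : 'M[R]_((r1 + r2) + (s1 + s2), r1 + s1) :=
  block_mx (col_mx 1%:M 0) 0 0 (col_mx 1%:M 0).

Definition sel2 (R : realType) r1 r2 s1 s2 : 'M[R]_((r1 + r2) + (s1 + s2), r2 + s2) :=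
  block_mx (col_mx 0 1%:M) 0 0 (col_mx 0 1%:M).

Lemma sel11 (R : realType) r1 r2 s1 s2 : (sel1 R r1 r2 s1 s2)^T *m sel1 R r1 r2 s1 s2 = 1%:M.
Proof.
rewrite /sel1 !tr_block_mx !tr_col_mx !trmx1 !trmx0 !mulmx_block !mul_row_col.
by rewrite !(mulmx1, mulmx0, mul0mx, addr0, add0r) -scalar_mx_block.
Qed.

Lemma sel22 (R : realType) r1 r2 s1 s2 : (sel2 R r1 r2 s1 s2)^T *m sel2 R r1 r2 s1 s2 = 1%:M.
Proof.
rewrite /sel2 !tr_block_mx !tr_col_mx !trmx1 !trmx0 !mulmx_block !mul_row_col.
by rewrite !(mulmx1, mulmx0, mul0mx, addr0, add0r) -scalar_mx_block.
Qed.

Lemma sel12 (R : realType) r1 r2 s1 s2 : (sel1 R r1 r2 s1 s2)^T *m sel2 R r1 r2 s1 s2 = 0.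
Proof.
rewrite /sel1 /sel2 !tr_block_mx !tr_col_mx !trmx1 !trmx0 !mulmx_block !mul_row_col.
by rewrite !(mulmx1, mulmx0, mul0mx, addr0, add0r) block_mx0.
Qed.

Lemma sel21 (R : realType) r1 r2 s1 s2 : (sel2 R r1 r2 s1 s2)^T *m sel1 R r1 r2 s1 s2 = 0.
Proof.
rewrite /sel1 /sel2 !tr_block_mx !tr_col_mx !trmx1 !trmx0 !mulmx_block !mul_row_col.
by rewrite !(mulmx1, mulmx0, mul0mx, addr0, add0r) block_mx0.
Qed.

Lemma sel1_proj (R : realType) r1 r2 s1 s2 :
  sel1 R r1 r2 s1 s2 *m (sel1 R r1 r2 s1 s2)^T =
  block_mx (block_mx 1%:M 0 0 0) 0 0 (block_mx 1%:M 0 0 0).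
Proof.
rewrite /sel1 !tr_block_mx !tr_col_mx !trmx1 !trmx0 !mulmx_block !mul_col_row.
by rewrite !(mul1mx, mulmx0, mul0mx, addr0, add0r).
Qed.

Lemma sel2_proj (R : realType) r1 r2 s1 s2 :
  sel2 R r1 r2 s1 s2 *m (sel2 R r1 r2 s1 s2)^T =
  block_mx (block_mx 0 0 0 1%:M) 0 0 (block_mx 0 0 0 1%:M).
Proof.
rewrite /sel2 !tr_block_mx !tr_col_mx !trmx1 !trmx0 !mulmx_block !mul_col_row.
by rewrite !(mul1mx, mulmx0, mul0mx, addr0, add0r).
Qed.

Lemma sel_split (R : realType) r1 r2 s1 s2 :
  sel1 R r1 r2 s1 s2 *m (sel1 R r1 r2 s1 s2)^T + sel2 R r1 r2 s1 s2 *m (sel2 R r1 r2 s1 s2)^T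
  = 1%:M.
Proof.
by rewrite sel1_proj sel2_proj !(add_block_mx, addr0, add0r) -!scalar_mx_block.
Qed.

(** In grouped coordinates P2 is the block upper triangular matrix (P R^T; 0 1), and Q2 below is the
    block lower triangular matrix (1 0; -R Q). *)
Lemma P2_ofE (R : realType) r1 r2 s1 s2 (P : 'M[R]_(r1 + s1)) (Rm : 'M[R]_(r2 + s2, r1 + s1)) :
  P2_of P Rm =
  sel1 R r1 r2 s1 s2 *m P *m (sel1 R r1 r2 s1 s2)^T
  + sel1 R r1 r2 s1 s2 *m Rm^T *m (sel2 R r1 r2 s1 s2)^T
  + sel2 R r1 r2 s1 s2 *m (sel2 R r1 r2 s1 s2)^T.
Proof.
rewrite sel2_proj -[in RHS](submxK P) -[in RHS](submxK Rm) /sel1 /sel2.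
rewrite !tr_block_mx !tr_col_mx !trmx1 !trmx0 !mulmx_block !mul_col_mx.
rewrite !(mul1mx, mulmx0, mul0mx, addr0, add0r) !mul_col_row.
by rewrite !(mul1mx, mulmx1, mulmx0, mul0mx, addr0, add0r) !(add_block_mx, addr0, add0r).
Qed.

Lemma Q2_ofE (R : realType) r1 r2 s1 s2 (Q : 'M[R]_(r2 + s2)) (Rm : 'M[R]_(r2 + s2, r1 + s1)) :
  Q2_of Q Rm =
  sel1 R r1 r2 s1 s2 *m (sel1 R r1 r2 s1 s2)^T
  - sel2 R r1 r2 s1 s2 *m Rm *m (sel1 R r1 r2 s1 s2)^T
  + sel2 R r1 r2 s1 s2 *m Q *m (sel2 R r1 r2 s1 s2)^T.
Proof.
rewrite sel1_proj -[in RHS](submxK Q) -[in RHS](submxK Rm) /sel1 /sel2.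
rewrite !tr_block_mx !tr_col_mx !trmx1 !trmx0 !mulmx_block !mul_col_mx.
rewrite !(mul1mx, mulmx0, mul0mx, addr0, add0r) !mul_col_row.
rewrite !(mul1mx, mulmx1, mulmx0, mul0mx, addr0, add0r).
by rewrite !(opp_block_mx, oppr0, add_block_mx, addr0, add0r).
Qed.

(** In grouped coordinates (P 0; R 1)(1 0; -R Q) = diag(P, Q): the two occurrences of R cancel. *)
Lemma P2TQ2 (R : realType) r1 r2 s1 s2 (P : 'M[R]_(r1 + s1)) (Q : 'M[R]_(r2 + s2))
    (Rm : 'M[R]_(r2 + s2, r1 + s1)) :
  P^T = P ->
  (P2_of P Rm)^T *m Q2_of Q Rm =
  sel1 R r1 r2 s1 s2 *m P *m (sel1 R r1 r2 s1 s2)^T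
  + sel2 R r1 r2 s1 s2 *m Q *m (sel2 R r1 r2 s1 s2)^T.
Proof.
move=> sP; rewrite P2_ofE Q2_ofE.
set J1 := sel1 R r1 r2 s1 s2; set J2 := sel2 R r1 r2 s1 s2.
have K11 p (N : 'M_(_, p)) : J1^T *m (J1 *m N) = N by rewrite mulmxA sel11 mul1mx.
have K12 p (N : 'M_(_, p)) : J1^T *m (J2 *m N) = 0 by rewrite mulmxA sel12 mul0mx.
have K21 p (N : 'M_(_, p)) : J2^T *m (J1 *m N) = 0 by rewrite mulmxA sel21 mul0mx.
have K22 p (N : 'M_(_, p)) : J2^T *m (J2 *m N) = N by rewrite mulmxA sel22 mul1mx.
rewrite !linearD /= !trmx_mul !trmxK sP.
rewrite !(mulmxDl, mulmxDr, mulmxN, mulNmx) -!mulmxA !(K11, K12, K21, K22).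
by rewrite !mulmx0 oppr0 !addr0 !add0r addrK.
Qed.

Lemma Q2TP2 (R : realType) r1 r2 s1 s2 (P : 'M[R]_(r1 + s1)) (Q : 'M[R]_(r2 + s2))
    (Rm : 'M[R]_(r2 + s2, r1 + s1)) :
  P^T = P -> Q^T = Q -> (Q2_of Q Rm)^T *m P2_of P Rm = (P2_of P Rm)^T *m Q2_of Q Rm.
Proof.
move=> sP sQ; rewrite -[LHS]trmxK trmx_mul trmxK P2TQ2//.
by rewrite linearD /= !trmx_mul !trmxK sP sQ !mulmxA.
Qed.

(** The identity blocks added by the lifting do not couple the groups, so the lifted [A22] is lower
    block triangular in grouped coordinates. *)
Lemma lifted_A22_sel (R : realType) n r1 r2 s1 s2 mp kp m k
    (G : plant R n (r1 + r2) (s1 + s2) mp kp m k) :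
  lower_block_triangular (A22 G) ->
  (sel1 R r1 r2 s1 s2)^T *m A22 (lifted_plant G) *m sel2 R r1 r2 s1 s2 = 0.
Proof.
rewrite /lower_block_triangular /= => T.
rewrite -[A22 G]submxK T /sel1 /sel2 !tr_block_mx !tr_col_mx !trmx1 !trmx0 !mulmx_block.
rewrite !(mulmx1, mulmx0, mul0mx, addr0, add0r, mulmxN, mulNmx) -!(scalemxAl, scalemxAr).
by rewrite mul_row_block !mul_row_col !(mulmx1, mulmx0, mul0mx, addr0) scaler0 oppr0 block_mx0.
Qed.

(** * Rescaling the multipliers to make U2 invertible *)

Lemma affine_line (R : realType) p q (A : 'M[R]_(p, q)) : affine (fun t : R^o => t *: A).
Proof.
have lin : linear (fun t : R^o => t *: A) by move=> a u v; rewrite scalerDl scalerA.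
pose L : {linear R^o -> 'M[R]_(p, q)} :=
  HB.pack (fun t : R^o => t *: A) (GRing.isLinear.Build R R^o _ _ _ lin).
exact: (affine_linear L).
Qed.

Ltac affine_tac := repeat first
  [ exact: affine_cst | exact: affine_line | assumption
  | apply: affine_block | apply: affine_row | apply: affine_col | apply: affine_cast
  | apply: affine_mull | apply: affine_mulr | apply: affineN | apply: affineZ
  | apply: affine_tr | apply: affineD ].

(** The product of the characteristic polynomials has fewer roots than its size, so one of the
    size-many distinct points 1 + e/(i+1) is not a root. *)
Lemma avoid_eigenvalues (R : realType) n (M1 M2 : 'M[R]_n) (e : R) :
  0 < e -> exists2 t : R, 0 < t <= e &
    M1 - (1 + t)%:M \in unitmx /\ M2 - (1 + t)%:M \in unitmx.
Proof.
move=> e0; pose p := char_poly M1 * char_poly M2.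
have pN0 : p != 0 by rewrite mulf_neq0 ?monic_neq0 ?char_poly_monic.
have unitE (M : 'M[R]_n) a : (M - a%:M \in unitmx) = ~~ root (char_poly M) a.
  by rewrite -eigenvalue_root_char /eigenvalue negbK /eigenspace kermx_eq0 row_free_unit.
pose f (i : nat) := 1 + e / i.+1%:R.
pose rs := [seq f i | i <- iota 0 (size p)].
have urs : uniq rs.
  rewrite map_inj_uniq ?iota_uniq// => i j /addrI/(mulfI (lt0r_neq0 e0))/invr_inj/eqP.
  by rewrite eqr_nat eqSS => /eqP.
have : ~~ all (root p) rs.
  apply/negP => ars; have := max_poly_roots pN0 ars urs.
  by rewrite size_map size_iota ltnn.
rewrite -has_predC => /hasP[_ /mapP[i _ ->]] /=; rewrite rootM negb_or => /andP[h1 h2].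
exists (e / i.+1%:R); last by rewrite !unitE.
by rewrite divr_gt0//= ler_pdivrMr// ler_peMr ?ler1n// ltW.
Qed.

(** The retained block contains neither the second factor of X2 nor the first factor of Y2. With P2
    and Q2 fixed, the synthesis system is therefore affine in P3 and Q1. *)
Lemma upper_part_row (R : realType) l p1 p2 q1 q2 (P1 : 'M[R]_(l, p1)) (P2 : 'M[R]_(l, p2))
    (A : 'M[R]_l) (Q1 : 'M[R]_(l, q1)) (Q2 : 'M[R]_(l, q2)) :
  upper_part ((row_mx P1 P2)^T *m A *m row_mx Q1 Q2) = block_mx 0 (P1^T *m A *m Q2) 0 0.
Proof. by rewrite /upper_part tr_row_mx mul_col_mx mul_col_row block_mxKur. Qed.

(* Both scaling classes are cones, so only the LMI restricts how far P3 and Q1 may be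
   scaled. *)
Lemma design_nondegenerate (R : realType) n l mp kp m k (gamma : R)
    (G : plant R n l l mp kp m k) (X1 Y1 : 'M[R]_n) (P2 P3 Q1 Q2 : 'M[R]_l)
    (K : system R n (l + l) (l + l) k m) :
  D K = 0 -> P2 \in unitmx -> P3 \in unitmx -> Q1 \in unitmx -> Q2 \in unitmx ->
  performance_lmi gamma 1%:M 1%:M (design_system G X1 Y1 (row_mx P2 P3) (row_mx Q1 Q2) K) ->
  exists2 t : R, 0 < t &
    [/\ Q2 - (t *: Q1) *m P2 \in unitmx, P2 - (t *: P3) *m Q2 \in unitmx &
      performance_lmi gamma 1%:M 1%:M
        (design_system G X1 Y1 (row_mx P2 (t *: P3)) (row_mx (t *: Q1) Q2) K)].
Proof.
move=> DK uP2 uP3 uQ1 uQ2 lmi.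
pose S (t : R^o) :=
  let X2 := row_mx P2 (P3 + t *: P3) in let Y2 := row_mx (Q1 + t *: Q1) Q2 in System
    (block_mx (A11 G *m Y1 + Bu1 G *m C1 K) (A11 G) (A11 K) (X1^T *m A11 G + B1 K *m Cy1 G))
    (block_mx (A12 G *m Y2 + Bu1 G *m C2 K) (A12 G) (A12 K) (X1^T *m A12 G + B1 K *m Cy2 G))
    (col_mx (B1 G) (X1^T *m B1 G + B1 K *m F G))
    (regroup (block_mx (A21 G *m Y1 + Bu2 G *m C1 K) (A21 G)
                       (A21 K) (X2^T *m A21 G + B2 K *m Cy1 G)))
    (regroup (block_mx (A22 G *m Y2 + Bu2 G *m C2 K) (A22 G)
                       (A22 K + block_mx 0 (P2^T *m A22 G *m Q2) 0 0)
                       (X2^T *m A22 G + B2 K *m Cy2 G)))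
    (regroup (col_mx (B2 G) (X2^T *m B2 G + B2 K *m F G)))
    (row_mx (C1 G *m Y1 + E G *m C1 K) (C1 G)) (row_mx (C2 G *m Y2 + E G *m C2 K) (C2 G))
    (D G).
have SE t : S t = design_system G X1 Y1 (row_mx P2 ((1 + t) *: P3))
                    (row_mx ((1 + t) *: Q1) Q2) K.
  by rewrite design_systemE// /S upper_part_row !scalerDl !scale1r.
have [] := @performance_lmi_open _ _ _ _ _ gamma _ _ S (trmx1 _ _) (trmx1 _ _);
  rewrite /=; try affine_tac.
  by rewrite SE addr0 !scale1r.
move=> e e0 open.
(* For instance Q2 - (1 + t) Q1 P2 = Q1 (Q1^-1 Q2 P2^-1 - (1 + t)) P2, so singularity means that 1 +
   t is an eigenvalue of the middle product. *)
have [t te [u1 u2]] := avoid_eigenvalues (invmx Q1 *m Q2 *m invmx P2)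
                         (invmx P3 *m P2 *m invmx Q2) e0.
have unit_diff (A B C : 'M[R]_l) : A \in unitmx -> C \in unitmx ->
    invmx A *m B *m invmx C - (1 + t)%:M \in unitmx -> B - ((1 + t) *: A) *m C \in unitmx.
  move=> uA uC u; have -> : B - ((1 + t) *: A) *m C =
      A *m (invmx A *m B *m invmx C - (1 + t)%:M) *m C.
    rewrite mulmxBr mulmxBl !mulmxA mulmxV// mul1mx mulmxKV//.
    by rewrite mul_mx_scalar.
  by rewrite !unitmx_mul uA u.
exists (1 + t); first by case/andP: te => t0 _; rewrite addr_gt0.
by split; [exact: unit_diff|exact: unit_diff|rewrite -SE; exact: open].
Qed.

(** * From synthesis variables to a controller *)

Lemma mul_usubmx (R : realType) p1 p2 q r (A : 'M[R]_(p1 + p2, q)) (B : 'M[R]_(q, r)) :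
  usubmx (A *m B) = usubmx A *m B.
Proof. by rewrite -{1}[A]vsubmxK mul_col_mx col_mxKu. Qed.

Lemma mul_rsubmx (R : realType) p q r1 r2 (A : 'M[R]_(p, q)) (B : 'M[R]_(q, r1 + r2)) :
  rsubmx (A *m B) = A *m rsubmx B.
Proof. by rewrite -{1}[B]hsubmxK mul_mx_row row_mxKr. Qed.

Lemma mul_ursubmx (R : realType) p1 p2 q r1 r2 (A : 'M[R]_(p1 + p2, q))
    (B : 'M[R]_(q, r1 + r2)) :
  ursubmx (A *m B) = usubmx A *m rsubmx B.
Proof. by rewrite /ursubmx mul_usubmx mul_rsubmx. Qed.

Lemma usub_rsub (R : realType) p1 p2 q1 q2 (A : 'M[R]_(p1 + p2, q1 + q2)) :
  usubmx (rsubmx A) = ursubmx A.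
Proof. by apply/matrixP => i j; rewrite !mxE. Qed.

Lemma ursubD (R : realType) p1 p2 q1 q2 (A B : 'M[R]_(p1 + p2, q1 + q2)) :
  ursubmx (A + B) = ursubmx A + ursubmx B.
Proof. by rewrite /ursubmx !linearD. Qed.

Lemma ursubN (R : realType) p1 p2 q1 q2 (A : 'M[R]_(p1 + p2, q1 + q2)) :
  ursubmx (- A) = - ursubmx A.
Proof. by rewrite /ursubmx !linearN. Qed.

Lemma usubmx_lsolve (R : realType) a1 a2 q (U11 : 'M[R]_a1) (U12 : 'M[R]_(a1, a2))
    (U22 : 'M[R]_a2) (A : 'M[R]_(a1 + a2, q)) :
  U11 \in unitmx -> usubmx ((block_mx U11 U12 0 U22)^T *m A) = 0 -> usubmx A = 0.
Proof.
move=> u; rewrite tr_block_mx trmx0 -{1}[A]vsubmxK mul_block_col col_mxKu mul0mx addr0.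
by move=> /(congr1 (mulmx (invmx U11^T))); rewrite mulmx0 mulKmx ?unitmx_tr.
Qed.

Lemma completion_inv (R : realType) p q (Y : 'M[R]_(p, q)) :
  let T := block_mx Y 1%:M 1%:M 0 : 'M[R]_(p + q, q + p) in
  let T' := block_mx 0 1%:M 1%:M (- Y) : 'M[R]_(q + p, p + q) in
  T *m T' = 1%:M /\ T' *m T = 1%:M.
Proof.
rewrite /= !mulmx_block !(mulmx0, mul0mx, mulmx1, mul1mx, addr0, add0r).
by rewrite !subrr -!scalar_mx_block.
Qed.

(** With identity blocks in place of V the transformation [T] is invertible, so P has to be T^-T Zt;
    it is symmetric because T^T P T = Zt T is. *)
Lemma completion (R : realType) p q (Y : 'M[R]_(p, q)) (Zt : 'M[R]_(q + p, p + q)) :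
  let T := block_mx Y 1%:M 1%:M 0 in
  (Zt *m T)^T = Zt *m T -> exists2 P : 'M[R]_(p + q), P^T = P & T^T *m P = Zt.
Proof.
have /= := completion_inv Y; set T := block_mx Y _ _ _; set T' := block_mx 0 _ _ _.
move=> [TT' T'T] /= sZ.
exists (T'^T *m Zt); last by rewrite mulmxA -trmx_mul T'T trmx1 mul1mx.
rewrite trmx_mul trmxK -[Zt^T]mul1mx -trmx1 -TT' trmx_mul -!mulmxA [T^T *m _]mulmxA.
by rewrite -trmx_mul sZ -!mulmxA TT' mulmx1.
Qed.

Lemma completion_image (R : realType) p q (Y : 'M[R]_(p, q)) (y : 'cV[R]_(p + q)) :
  exists x, y = block_mx Y 1%:M 1%:M 0 *m x.
Proof.
have [TT' _] := completion_inv Y; exists (block_mx 0 1%:M 1%:M (- Y) *m y).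
by rewrite mulmxA TT' mul1mx.
Qed.

(** The change of controller variables is solved backwards with V1 = V2 = 1, which fixes the orders
    n and 2l. The inverse of U2^T is lower block triangular, and [upper_part] cancels exactly the
    upper block of [X2^T *m A22 G *m Y2], so the recovered [A22] is again lower block triangular. *)
Lemma controller_recovery (R : realType) n l mp kp m k (G : plant R n l l mp kp m k)
    (Kd : system R n (l + l) (l + l) k m) (X1 Y1 : 'M[R]_n) (U1 : 'M[R]_n)
    (X2 Y2 : 'M[R]_(l, l + l)) (U11 U12 U22 : 'M[R]_l) :
  zero_feedthrough Kd -> U1 \in unitmx -> U11 \in unitmx -> U22 \in unitmx ->
  let U2 := block_mx U11 U12 0 U22 in
  exists K : system R n (l + l) (l + l) k m,
  zero_feedthrough K /\
  [/\ B1 Kd = U1^T *m B1 K, B2 Kd = U2^T *m B2 K,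
  C1 Kd = C1 K *m 1%:M & C2 Kd = C2 K *m 1%:M] /\
  [/\ A11 Kd = X1^T *m A11 G *m Y1 + X1^T *m Bu1 G *m (C1 K *m 1%:M)
           + U1^T *m B1 K *m (Cy1 G *m Y1) + U1^T *m A11 K *m 1%:M,
  A12 Kd = X1^T *m A12 G *m Y2 + X1^T *m Bu1 G *m (C2 K *m 1%:M)
           + U1^T *m B1 K *m (Cy2 G *m Y2) + U1^T *m A12 K *m 1%:M,
  A21 Kd = X2^T *m A21 G *m Y1 + X2^T *m Bu2 G *m (C1 K *m 1%:M)
           + U2^T *m B2 K *m (Cy1 G *m Y1) + U2^T *m A21 K *m 1%:M &
  A22 Kd + upper_part (X2^T *m A22 G *m Y2) =
           X2^T *m A22 G *m Y2 + X2^T *m Bu2 G *m (C2 K *m 1%:M)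
           + U2^T *m B2 K *m (Cy2 G *m Y2) + U2^T *m A22 K *m 1%:M].
Proof.
move=> [tA tB tC DK] u1 u11 u22 U2.
have u1T : U1^T \in unitmx by rewrite unitmx_tr.
have u2T : U2^T \in unitmx by rewrite unitmx_tr unitmxE det_ublock unitrM -!unitmxE u11.
pose W1 := invmx U1^T; pose W2 := invmx U2^T.
exists (System
  (W1 *m (A11 Kd - (X1^T *m A11 G *m Y1 + X1^T *m Bu1 G *m C1 Kd + B1 Kd *m (Cy1 G *m Y1))))
  (W1 *m (A12 Kd - (X1^T *m A12 G *m Y2 + X1^T *m Bu1 G *m C2 Kd + B1 Kd *m (Cy2 G *m Y2))))
  (W1 *m B1 Kd)
  (W2 *m (A21 Kd - (X2^T *m A21 G *m Y1 + X2^T *m Bu2 G *m C1 Kd + B2 Kd *m (Cy1 G *m Y1))))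
  (W2 *m (A22 Kd + upper_part (X2^T *m A22 G *m Y2)
     - (X2^T *m A22 G *m Y2 + X2^T *m Bu2 G *m C2 Kd + B2 Kd *m (Cy2 G *m Y2))))
  (W2 *m B2 Kd) (C1 Kd) (C2 Kd) 0).
rewrite /zero_feedthrough /= !mulmx1 !mulKVmx//.
split; last by split; split=> //; rewrite [RHS]addrC subrK.
have usolve q (A : 'M_(_, q)) : usubmx A = 0 -> usubmx (W2 *m A) = 0.
  by move=> h; apply: (usubmx_lsolve (U12 := U12) (U22 := U22) u11); rewrite mulKVmx.
split=> //; last exact: usolve.
rewrite /lower_block_triangular -usub_rsub mul_rsubmx; apply: usolve; rewrite usub_rsub.
rewrite !(ursubD, ursubN) tA /upper_part block_mxKur add0r.
rewrite [ursubmx (_ *m C2 Kd)]mul_ursubmx tC mulmx0 addr0.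
by rewrite [ursubmx (B2 Kd *m _)]mul_ursubmx tB mul0mx addr0 subrr.
Qed.

Lemma affine_Delta_l (R : realType) rD sD : affine (@Delta_l R rD sD).
Proof.
have aid : affine (fun M : 'M[R]_(rD, sD) => M) by exact: (affine_linear idfun).
by rewrite /Delta_l /hatDelta /diag2; affine_tac.
Qed.

(** If x = Y X x, the vector (X x; -x) lies in the kernel of the coupling matrix. *)
Lemma coupling_unit (R : realType) n (X Y : 'M[R]_n) :
  posdef (block_mx Y 1%:M 1%:M X) -> 1%:M - Y *m X \in unitmx.
Proof.
case/posdefP => _ H; apply: unitmx_inj => x.
rewrite mulmxBl mul1mx => /eqP; rewrite subr_eq0 => /eqP xE.
apply/eqP/negPn/negP => x0.
have := H (col_mx (X *m x) (- x)); rewrite col_mx_eq0 negb_and oppr_eq0 x0 orbT => /(_ isT).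
by rewrite mul_block_col !mul1mx mulmxA -xE mulmxN !subrr col_mx0 dot0r ltxx.
Qed.

(** The lower right factor U1 is 1 - Y1 X1 because then T^T X T is the coupling matrix itself, so
    both symmetry and definiteness of X are inherited from it. *)
Lemma state_completion (R : realType) n (X1 Y1 : 'M[R]_n) :
  X1^T = X1 -> Y1^T = Y1 -> posdef (block_mx Y1 1%:M 1%:M X1) ->
  exists2 X : 'M[R]_(n + n), posdef X &
    (block_mx Y1 1%:M 1%:M 0)^T *m X = (block_mx 1%:M X1 0 (1%:M - Y1 *m X1))^T.
Proof.
move=> sX sY pd; set Zt := (block_mx 1%:M X1 0 _)^T.
have ZtT : Zt *m block_mx Y1 1%:M 1%:M 0 = block_mx Y1 1%:M 1%:M X1.
  rewrite /Zt tr_block_mx trmx0 mulmx_block !(mulmx1, mul0mx, mulmx0, addr0, trmx1, mul1mx).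
  by rewrite linearB /= trmx1 trmx_mul sX sY addrC subrK.
have /posdefP[sW W0] := pd; rewrite -ZtT in sW.
have [X symX XE] := completion sW; exists X => //.
apply/posdefP; split=> // y; have [x ->] := completion_image Y1 y => y0.
rewrite (dot_mull _ x) [_^T *m _]mulmxA XE mulmxA ZtT; apply: W0.
by apply: contra y0 => /eqP ->; rewrite mulmx0.
Qed.

(** Once the lower left block is set to zero, symmetry of T^T P T forces the other three blocks:
    that matrix becomes (Q1 Q2 1; Q2^T P2^T Q2 P2^T; 1 P2 P3), whose middle entry is symmetric by
    the special form of P2 and Q2. *)
Definition multiplier_U (R : realType) l (P2 P3 Q1 Q2 : 'M[R]_l) : 'M[R]_(l + l) :=
  block_mx (Q2 - Q1 *m P2) (1%:M - Q1 *m P3) 0 (P2^T - Q2^T *m P3).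

Lemma regroup_block (R : realType) l (A B C D E F G H I : 'M[R]_l) :
  regroup (block_mx (row_mx A B) C (block_mx D E F G) (col_mx H I)) =
  block_mx (block_mx A B D E) (col_mx C H) (row_mx F G) I.
Proof.
rewrite block_mxEv [block_mx D E F G]block_mxEv -block_mxEh block_mxEv regroup_col.
by rewrite [RHS]block_mxEv [block_mx A B D E]block_mxEv -[row_mx (col_mx _ _) _]block_mxEh.
Qed.

Lemma multiplier_completion (R : realType) l (P2 P3 Q1 Q2 : 'M[R]_l) :
  P3^T = P3 -> Q1^T = Q1 -> Q2^T *m P2 = P2^T *m Q2 ->
  exists2 P : 'M[R]_(l + (l + l)), P^T = P &
    (block_mx (row_mx Q1 Q2) 1%:M 1%:M 0)^T *m P =
    regroup (block_mx 1%:M (row_mx P2 P3) 0 (multiplier_U P2 P3 Q1 Q2))^T.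
Proof.
move=> sP sQ sPQ; apply: completion; rewrite regroup_mul.
have -> : (block_mx 1%:M (row_mx P2 P3) 0 (multiplier_U P2 P3 Q1 Q2))^T
    *m block_mx (row_mx Q1 Q2) 1%:M 1%:M 0 =
    block_mx (row_mx Q1 Q2) 1%:M (block_mx Q2^T (P2^T *m Q2) 1%:M P2) (col_mx P2^T P3).
  rewrite tr_block_mx trmx0 mulmx_block !(mulmx1, mul0mx, mulmx0, addr0, trmx1, mul1mx).
  rewrite tr_row_mx mul_col_row /multiplier_U tr_block_mx trmx0 sP.
  rewrite !linearB /= trmx1 !trmx_mul !trmxK sP sQ.
  by rewrite add_block_mx addr0 !(addrC (_ *m _)) !subrK.
rewrite regroup_block !tr_block_mx !tr_col_mx !tr_row_mx !trmx1 !trmxK sP sQ.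
by rewrite trmx_mul trmxK sPQ.
Qed.

(** The equation for [Dc] prescribes the four blocks of T^T P diag(Dl, Dc) T that contain [Dc].
    Three of them are set to the negative transposes of the opposite blocks and drop out of the
    form; the remaining one is left at P2^T Dl Q2. *)
Lemma scheduling_form (R : realType) l (Dl P2 P3 Q1 Q2 : 'M[R]_l) (P : 'M[R]_(l + (l + l)))
    (Dc : 'M[R]_(l + l)) y1 y2 y3 :
  P3^T = P3 ->
  let T := block_mx (row_mx Q1 Q2) 1%:M 1%:M 0 in
  T^T *m P = regroup (block_mx 1%:M (row_mx P2 P3) 0 (multiplier_U P2 P3 Q1 Q2))^T ->
  (multiplier_U P2 P3 Q1 Q2)^T *m Dc =
    block_mx (- (Dl *m Q2)^T) (P2^T *m Dl *m Q2) (- Dl^T) (- (P2^T *m Dl)^T)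
    - (row_mx P2 P3)^T *m Dl *m row_mx Q1 Q2 ->
  let y := T *m col_mx (col_mx y1 y2) y3 in
  dot y (P *m (diag2 Dl Dc *m y)) =
  dot y1 (Q1^T *m (Dl^T *m y1)) + dot y2 (P2^T *m Dl *m Q2 *m y2) + dot y3 (P3 *m (Dl *m y3)).
Proof.
move=> sP T PE DcE y.
rewrite /y dot_mull [_ *m (P *m _)]mulmxA PE !mulmxA !regroup_mul.
have -> : (block_mx 1%:M (row_mx P2 P3) 0 (multiplier_U P2 P3 Q1 Q2))^T *m diag2 Dl Dc *m T =
    block_mx (row_mx (Dl *m Q1) (Dl *m Q2)) Dl
      (block_mx (- (Dl *m Q2)^T) (P2^T *m Dl *m Q2) (- Dl^T) (- (P2^T *m Dl)^T))
      (col_mx (P2^T *m Dl) (P3 *m Dl)).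
  rewrite /diag2 tr_block_mx trmx0 !mulmx_block.
  rewrite !(mulmx1, mul0mx, mulmx0, addr0, add0r, trmx1, mul1mx) DcE mul_mx_row.
  by rewrite addrC subrK tr_row_mx mul_col_mx sP.
rewrite -regroup_mul regroup_block !(mul_block_col, mul_col_mx, mul_row_col) add_col_mx !dot_col.
rewrite !(mulNmx, dotDr, dotNr).
rewrite -[dot y2 ((Dl *m Q2)^T *m y1)]dot_mull -[dot y3 (Dl^T *m y1)]dot_mull.
rewrite -[dot y3 ((P2^T *m Dl)^T *m y2)]dot_mull.
rewrite -[Q1^T *m _]trmx_mul -[dot y1 ((Dl *m Q1)^T *m y1)]dot_mull.
rewrite [dot (Dl *m Q2 *m y2) _]dotC [dot (Dl *m y3) _]dotC [dot _ y2]dotC [dot _ y1]dotC.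
ring.
Qed.

Lemma design_sufficient (R : realType) n m k mp kp rD sD (V : set 'M[R]_(rD, sD))
    (G : plant R n (rD + rD) (sD + sD) mp kp m k) (gamma : R) :
  V 0 -> design_conditions V G gamma ->
  let l := ((rD + rD) + (sD + sD))%N in
  exists (K : system R n (l + l) (l + l) k m),
  exists (Dc : 'M[R]_(rD, sD) -> 'M[R]_(l + l)) (X1 : 'M[R]_(n + n)),
  exists P : 'M[R]_((rD + rD) + (sD + sD) + (l + l)),
    robust_controller V G gamma K Dc X1 P /\ affine_on V Dc.
Proof.
move=> V0 [X1 [Y1 [P3 [Q1 [Pm [Qm [Rm [Kd H]]]]]]]] l; move: H.
set P2 := P2_of Pm Rm; set Q2 := Q2_of Qm Rm => /=.
move=> [[/symmetricmxP sX1 /symmetricmxP sY1] [pP3 dQ1 /symmetricmxP sPm /symmetricmxP sQm]].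
move=> zK [lmi pd] pV.
have sP3 : P3^T = P3 by case: pP3 => /symmetricmxP.
have sQ1 : Q1^T = Q1 by case: dQ1 => /symmetricmxP.
have DKd : D Kd = 0 by case: zK.
have midV M x : V M -> x != 0 -> 0 < dot x (P2^T *m Delta_l M *m Q2 *m x).
  by move=> /pV/symm_part_posdefP; apply.
(* Since 0 lies in [V], each of the three forms is positive there; the matrix product behind it is
   invertible, hence so are its factors. *)
have /andP[uP3 _] : (P3 \in unitmx) && (Delta_l (0 : 'M[R]_(rD, sD)) \in unitmx).
  rewrite -unitmx_mul; apply: posform_unit => x x0; rewrite -mulmxA.
  exact: (primal_scalings_form pP3).
have /andP[uQ1 _] : (Q1 \in unitmx) && ((Delta_l (0 : 'M[R]_(rD, sD)))^T \in unitmx).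
  rewrite -unitmx_mul; apply: posform_unit => x x0; rewrite -mulmxA.
  exact: (dual_scalings_form dQ1).
have : P2^T *m Delta_l 0 *m Q2 \in unitmx by apply: posform_unit => x; apply: midV.
rewrite !unitmx_mul unitmx_tr => /andP[/andP[uP2 _] uQ2].
have [t t0 [uU11 uU22 {}lmi]] := design_nondegenerate DKd uP2 uP3 uQ1 uQ2 lmi.
have formP3 M x : V M -> x != 0 -> 0 < dot x (t *: P3 *m (Delta_l M *m x)).
  by move=> VM x0; rewrite -scalemxAl dotZr mulr_gt0// (primal_scalings_form pP3).
have formQ1 M x : V M -> x != 0 -> 0 < dot x ((t *: Q1)^T *m ((Delta_l M)^T *m x)).
  move=> VM x0; rewrite linearZ /= sQ1 -scalemxAl dotZr mulr_gt0//.
  exact: (dual_scalings_form dQ1).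
have {}sP3 : (t *: P3)^T = t *: P3 by rewrite linearZ /= sP3.
have {}sQ1 : (t *: Q1)^T = t *: Q1 by rewrite linearZ /= sQ1.
move: (t *: P3) (t *: Q1) sP3 sQ1 uU11 uU22 lmi formP3 formQ1.
move=> {P3 Q1 uP3 uQ1 pP3 dQ1 t t0} P3 Q1 sP3 sQ1 uU11 uU22 lmi formP3 formQ1.
have {}uU22 : P2^T - Q2^T *m P3 \in unitmx.
  by rewrite -unitmx_tr linearB /= trmxK trmx_mul trmxK sP3.
have uU1 := coupling_unit pd.
have [X pX XE] := state_completion sX1 sY1 pd.
have [P sP PE] := multiplier_completion sP3 sQ1 (Q2TP2 Rm sPm sQm).
pose U := multiplier_U P2 P3 Q1 Q2.
have uU : U^T \in unitmx.
  by rewrite unitmx_tr /U /multiplier_U unitmxE det_ublock unitrM -!unitmxE uU11.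
(* The upper right block of this expression is P2^T Dl Q2 - P2^T Dl Q2 = 0, which makes the
   scheduling function lower block triangular; linearity in [Dl] makes it affine. *)
pose S (Dl : 'M[R]_l) :=
  block_mx (- (Dl *m Q2)^T) (P2^T *m Dl *m Q2) (- Dl^T) (- (P2^T *m Dl)^T)
  - (row_mx P2 P3)^T *m Dl *m row_mx Q1 Q2.
pose Dc M := invmx U^T *m S (@Delta_l R rD sD M).
have DcE M : U^T *m Dc M = S (Delta_l M) by rewrite mulKVmx.
have [K [zKc [[B1E B2E C1E C2E] [A11E A12E A21E A22E]]]] :=
  controller_recovery (lifted_plant G) X1 Y1 (row_mx P2 P3) (row_mx Q1 Q2)
    (1%:M - Q1 *m P3) zK uU1 uU11 uU22.
have DK : D K = 0 by case: zKc.
exists K, Dc, X, P; split; first split=> //.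
- split=> // M _; rewrite /lower_block_triangular -usub_rsub.
  apply: (@usubmx_lsolve _ _ _ _ _ (1%:M - Q1 *m P3) (P2^T - Q2^T *m P3) _ uU11).
  rewrite -mul_rsubmx [_^T *m Dc M](DcE M) usub_rsub /S tr_row_mx (mul_col_mx P2^T).
  by rewrite mul_col_row opp_block_mx add_block_mx block_mxKur subrr.
- apply/full_scalingsP; split=> // M y VM y0.
  have [x xE] := completion_image (row_mx Q1 Q2) y.
  rewrite -[x]vsubmxK -[usubmx x]vsubmxK in xE.
  set y1 := usubmx (usubmx x) in xE; set y2 := dsubmx (usubmx x) in xE.
  set y3 := dsubmx x in xE.
  rewrite xE (scheduling_form _ _ _ sP3 PE (DcE M)).
  have ge0 (f : 'cV[R]_l -> R) z : f 0 = 0 -> (z != 0 -> 0 < f z) -> 0 <= f z.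
    by move=> f0 H; have [->|/H/ltW//] := eqVneq z 0; rewrite f0.
  have h1 := formQ1 M y1 VM; have h2 := midV M y2 VM; have h3 := formP3 M y3 VM.
  have : [|| y1 != 0, y2 != 0 | y3 != 0].
    by move: y0; rewrite xE; apply: contraR; rewrite !negb_or !negbK;
      move=> /and3P[/eqP-> /eqP-> /eqP->];
      rewrite !col_mx0 mulmx0.
  have := ge0 (fun z => dot z (Q1^T *m ((Delta_l M)^T *m z))) y1 (dot0l _) h1.
  have := ge0 (fun z => dot z (P2^T *m Delta_l M *m Q2 *m z)) y2 (dot0l _) h2.
  have := ge0 (fun z => dot z (P3 *m (Delta_l M *m z))) y3 (dot0l _) h3.
  by move=> ? ? ? /or3P[/h1|/h2|/h3]; lra.
- have [sX _] := posdefP X; have {sX} [sX _] := sX pX.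
  apply/performance_lmiP => // y1 y2 d.
  have [x ->] := completion_image Y1 y1; have [w ->] := completion_image (row_mx Q1 Q2) y2.
  move=> yN0; rewrite -(perf_form_design gamma (Kd := Kd) x w d XE PE)//.
  apply: (performance_lmiP _ _ (trmx1 _ _) (trmx1 _ _)).1 => //.
  apply: contra yN0; rewrite !col_mx_eq0 => /andP[/andP[/eqP-> /eqP->] ->].
  by rewrite !mulmx0 !eqxx.
have aS : affine (fun M => Dc M).
  have aD := @affine_Delta_l R rD sD.
  by rewrite /Dc /S; affine_tac.
by case: aS => L [C aS]; exists L, C => M _; exact: aS.
Qed.

(** * Recovering strict inequalities from semidefinite ones *)

Lemma performance_lmi_coercive (R : realType) nx nw mp kp (gamma : R) (X : 'M[R]_nx)
    (P : 'M[R]_nw) (S : system R nx nw nw mp kp) :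
  X^T = X -> P^T = P -> performance_lmi gamma X P S ->
  exists2 c : R, 0 < c &
    forall x w d, perf_form gamma X P S x w d <= - (c * (dot x x + dot w w + dot d d)).
Proof.
move=> sX sP /negdefN/posdef_coercive[c c0 H]; exists c => // x w d.
have := H (col_mx (col_mx x w) d); rewrite mulNmx dotNr perf_formE// !dot_col.
by rewrite lerNr.
Qed.

Lemma perf_form_shift (R : realType) nx nw mp kp (gamma : R) (X : 'M[R]_nx) (P : 'M[R]_nw)
    (A11 dA11 : 'M[R]_nx) A12 (B1 : 'M[R]_(nx, mp)) A21 (A22 dA22 : 'M[R]_nw) B2
    (C1 : 'M[R]_(kp, nx)) C2 D x w d :
  perf_form gamma X P (System (A11 + dA11) A12 B1 A21 (A22 + dA22) B2 C1 C2 D) x w d =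
  perf_form gamma X P (System A11 A12 B1 A21 A22 B2 C1 C2 D) x w d
  + 2 * dot x (X *m (dA11 *m x)) + 2 * dot w (P *m (dA22 *m w)).
Proof. by rewrite /perf_form /= !mulmxDl !mulmxDr !dotDr; ring. Qed.

Lemma regroupD (R : realType) l q (M N : 'M[R]_(l + (l + l), q)) :
  regroup (M + N) = regroup M + regroup N.
Proof.
by rewrite /regroup; move: (addnA l l l) M N => e; case: _ / e => M N; rewrite !castmx_id.
Qed.

Lemma block_mx_shift (R : realType) p1 p2 q1 q2 (A : 'M[R]_(p1, q1)) (B : 'M[R]_(p1, q2))
    (C C' : 'M[R]_(p2, q1)) (D : 'M[R]_(p2, q2)) :
  block_mx A B (C + C') D = block_mx A B C D + block_mx 0 0 C' 0.
Proof. by rewrite add_block_mx !addr0. Qed.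

(* The first block rows of the two congruence transformations may vanish on a nontrivial
   subspace; there the controller variables are shifted by Y1^-1, Q1^-1 and Q2^-T so as to
   produce - |x1|^2 - |w1|^2 - |w2|^2. *)
Lemma design_strict (R : realType) n l mp kp m k (gamma : R) (G : plant R n l l mp kp m k)
    (X1 Y1 : 'M[R]_n) (X2 : 'M[R]_(l, l + l)) (Q1 Q2 : 'M[R]_l)
    (K : system R n (l + l) (l + l) k m) (c : R) :
  zero_feedthrough K -> Y1^T = Y1 -> Q1^T = Q1 ->
  Y1 \in unitmx -> Q1 \in unitmx -> Q2 \in unitmx -> 0 < c ->
  (forall x1 x2 w1 w2 w3 d,
     perf_form gamma 1%:M 1%:M (design_system G X1 Y1 X2 (row_mx Q1 Q2) K)
       (col_mx x1 x2) (col_mx (col_mx w1 w2) w3) d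
     <= - (c * (dot (Y1 *m x1 + x2) (Y1 *m x1 + x2)
        + dot (Q1 *m w1 + Q2 *m w2 + w3) (Q1 *m w1 + Q2 *m w2 + w3) + dot d d))) ->
  exists2 K', zero_feedthrough K' &
    performance_lmi gamma 1%:M 1%:M (design_system G X1 Y1 X2 (row_mx Q1 Q2) K').
Proof.
move=> [tA tB tC DK] sY sQ uY uQ1 uQ2 c0 H.
have [Ka Ka0 HKa] := cross_bounded (invmx Y1).
have [Kb Kb0 HKb] := cross_bounded (invmx Q1).
have [Kc Kc0 HKc] := cross_bounded (invmx Q2)^T.
have [K0 K0E] : exists x, x = Ka + Kb + Kc + 1 by eexists.
have K0gt : 0 < K0 by lra.
(* The shift is weighted so that the Young terms, e Ka |s|^2 and e (Kb + Kc) |t|^2 for the residuals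
   s and t below, are absorbed by the margin c, with e to spare. *)
have [e eE] : exists x, x = c / K0 by eexists.
have e0 : 0 < e by rewrite eE divr_gt0.
have ceE : c = e * (Ka + Kb + Kc + 1) by rewrite eE -K0E divfK// gt_eqF.
(* After substituting w3 = t - Q1 w1 - Q2 w2, the last block row of [dK] yields -|w1|^2 - |w2|^2 and
   two cross terms in w1 and w2; [d11] cancels these. The upper right block of [dK] stays zero, as
   the structure requires. *)
pose d11 := Q2^T *m invmx Q1 + invmx Q2 *m Q1.
pose dK := block_mx d11 0 (invmx Q1) (invmx Q2)^T : 'M[R]_(l + l).
pose K' := System (A11 K + e *: invmx Y1) (A12 K) (B1 K) (A21 K) (A22 K + e *: dK) (B2 K)
             (C1 K) (C2 K) (D K).
have tA' : lower_block_triangular (A22 K + e *: dK).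
  rewrite /lower_block_triangular /ursubmx !linearD /= -!/(ursubmx _) tA add0r.
  by rewrite /dK scale_block_mx block_mxKur scaler0.
exists K' => //; apply/performance_lmiP; rewrite ?trmx1// => x w d.
rewrite -[x]vsubmxK -[w]vsubmxK -[usubmx w]vsubmxK.
set x1 := usubmx x; set x2 := dsubmx x; set w1 := usubmx (usubmx w).
set w2 := dsubmx (usubmx w); set w3 := dsubmx w => N0.
have -> : perf_form gamma 1%:M 1%:M (design_system G X1 Y1 X2 (row_mx Q1 Q2) K')
      (col_mx x1 x2) (col_mx (col_mx w1 w2) w3) d =
    perf_form gamma 1%:M 1%:M (design_system G X1 Y1 X2 (row_mx Q1 Q2) K)
      (col_mx x1 x2) (col_mx (col_mx w1 w2) w3) d
    + 2 * e * (dot x2 (invmx Y1 *m x1))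
    + 2 * e * (dot w2 (d11 *m w1) + dot w3 (invmx Q1 *m w1 + (invmx Q2)^T *m w2)).
  rewrite !design_systemE//=.
  rewrite (block_mx_shift _ _ _ (e *: invmx Y1)) (addrAC _ (e *: dK)).
  rewrite (block_mx_shift _ _ _ (e *: dK)) regroupD perf_form_shift !mul1mx.
  rewrite mul_block_col !mul0mx !addr0 dot_col dot0r add0r -scalemxAl dotZr.
  rewrite regroup_mul mul_block_col !mul0mx !addr0 -scalemxAl /dK mul_block_col mul0mx addr0.
  rewrite scale_col_mx regroup_col !dot_col dot0r add0r !dotZr; ring.
have [s sE] : exists s, s = Y1 *m x1 + x2 by eexists.
have [t tE] : exists t, t = Q1 *m w1 + Q2 *m w2 + w3 by eexists.
have x2E : x2 = s - Y1 *m x1 by rewrite sE addrC addKr.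
have w3E : w3 = t - (Q1 *m w1 + Q2 *m w2) by rewrite tE addrC addKr.
have -> : dot x2 (invmx Y1 *m x1) = dot s (invmx Y1 *m x1) - dot x1 x1.
  by rewrite x2E dotDl dotNl (dot_mull Y1) sY mulKVmx.
have -> : dot w2 (d11 *m w1) + dot w3 (invmx Q1 *m w1 + (invmx Q2)^T *m w2) =
    dot t (invmx Q1 *m w1) + dot t ((invmx Q2)^T *m w2) - dot w1 w1 - dot w2 w2.
  rewrite w3E /d11 mulmxDl -!mulmxA !(dotDl, dotDr, dotNl).
  rewrite -(dot_mull Q2) [dot w2 (invmx Q2 *m _)]dotC (dot_mull (invmx Q2)).
  rewrite [dot (Q1 *m w1) (invmx Q1 *m w1)]dot_mull sQ mulKVmx//.
  rewrite [dot (Q2 *m w2) (_^T *m w2)]dot_mull [Q2^T *m (_ *m w2)]mulmxA -trmx_mul mulVmx//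
    trmx1 mul1mx.
  ring.
have hs := HKa s x1; have ht1 := HKb t w1; have ht2 := HKc t w2.
have hF := H x1 x2 w1 w2 w3 d; rewrite -sE -tE in hF.
move: hs ht1 ht2 hF.
have ss := dot_ge0 s; have tt := dot_ge0 t; have dd := dot_ge0 d.
have xx := dot_ge0 x1; have ww1 := dot_ge0 w1; have ww2 := dot_ge0 w2.
have : 0 < dot s s + dot t t + dot d d + dot x1 x1 + dot w1 w1 + dot w2 w2.
  rewrite lt_neqAle !addr_ge0// andbT eq_sym; apply: contra N0.
  rewrite !paddr_eq0 ?addr_ge0// => /andP[/andP[/andP[/andP[/andP[]]]]].
  move=> /eqP/dot_eq0 s0 /eqP/dot_eq0 t0 /eqP/dot_eq0 -> /eqP/dot_eq0 x10.
  move=> /eqP/dot_eq0 w10 /eqP/dot_eq0 w20.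
  by rewrite x2E w3E s0 t0 x10 w10 w20 !mulmx0 addr0 !subrr !col_mx0.
move: (dot s s) (dot t t) (dot d d) (dot x1 x1) (dot w1 w1) (dot w2 w2) ss tt dd xx ww1 ww2.
move: (dot s _) (dot t _) (dot t _) (perf_form _ _ _ _ _ _ _).
move=> a1 a2 a3 f ss tt dd xx w1w1 w2w2 ss0 tt0 dd0 xx0 w10 w20 pos h1 h2 h3 hf.
have g1 := ler_pM2l e0; move: h1 h2 h3; rewrite -!(g1 (2 * _)) => h1 h2 h3.
have g2 : 0 < e * (ss + tt + dd + xx + w1w1 + w2w2) by rewrite mulr_gt0.
have h5 : 0 <= e * (Ka * tt) by rewrite !mulr_ge0// ltW.
have h6 : 0 <= e * (Kb * ss) by rewrite !mulr_ge0// ltW.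
have h7 : 0 <= e * (Kc * ss) by rewrite !mulr_ge0// ltW.
have h8 : 0 <= e * (Ka * dd) by rewrite !mulr_ge0// ltW.
have h9 : 0 <= e * (Kb * dd) by rewrite !mulr_ge0// ltW.
have h10 : 0 <= e * (Kc * dd) by rewrite !mulr_ge0// ltW.
rewrite ceE in hf; lra.
Qed.

(** X1 enters the inequality affinely, so X1 + t is allowed for small t > 0. The coupling form then
    gains t |x|^2, and where x = 0 it reduces to the form of Y1. *)
Lemma design_coupling_strict (R : realType) n l mp kp m k (gamma : R)
    (G : plant R n l l mp kp m k) (X1 Y1 : 'M[R]_n) (X2 Y2 : 'M[R]_(l, l + l))
    (K : system R n (l + l) (l + l) k m) :
  D K = 0 -> X1^T = X1 -> posdef Y1 ->
  (forall v, 0 <= dot v (block_mx Y1 1%:M 1%:M X1 *m v)) ->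
  performance_lmi gamma 1%:M 1%:M (design_system G X1 Y1 X2 Y2 K) ->
  exists X : 'M[R]_n, [/\ X^T = X, posdef (block_mx Y1 1%:M 1%:M X) &
    performance_lmi gamma 1%:M 1%:M (design_system G X Y1 X2 Y2 K)].
Proof.
move=> DK sX pY; have /posdefP[sY pY'] := pY => W0 lmi.
pose X (t : R^o) := X1 + t *: 1%:M.
pose S (t : R^o) := System
    (block_mx (A11 G *m Y1 + Bu1 G *m C1 K) (A11 G) (A11 K) ((X t)^T *m A11 G + B1 K *m Cy1 G))
    (block_mx (A12 G *m Y2 + Bu1 G *m C2 K) (A12 G) (A12 K) ((X t)^T *m A12 G + B1 K *m Cy2 G))
    (col_mx (B1 G) ((X t)^T *m B1 G + B1 K *m F G))
    (regroup (block_mx (A21 G *m Y1 + Bu2 G *m C1 K) (A21 G)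
                       (A21 K) (X2^T *m A21 G + B2 K *m Cy1 G)))
    (regroup (block_mx (A22 G *m Y2 + Bu2 G *m C2 K) (A22 G)
                       (A22 K + upper_part (X2^T *m A22 G *m Y2))
                       (X2^T *m A22 G + B2 K *m Cy2 G)))
    (regroup (col_mx (B2 G) (X2^T *m B2 G + B2 K *m F G)))
    (row_mx (C1 G *m Y1 + E G *m C1 K) (C1 G)) (row_mx (C2 G *m Y2 + E G *m C2 K) (C2 G))
    (D G).
have SE t : S t = design_system G (X t) Y1 X2 Y2 K by rewrite design_systemE.
have [] := @performance_lmi_open _ _ _ _ _ gamma _ _ S (trmx1 _ _) (trmx1 _ _);
  rewrite /= /X; try affine_tac.
  by rewrite SE /X scale0r addr0.
move=> t t0 /(_ t); rewrite t0 lexx SE => /(_ isT) lmi'.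
have sXt : (X t)^T = X t by rewrite linearD linearZ /= trmx1 sX.
exists (X t); split=> //; apply/posdefP; split=> [|v v0].
  by rewrite tr_block_mx !trmx1 sY sXt.
have := W0 v; rewrite -[v]vsubmxK in v0 *; move: (usubmx v) (dsubmx v) v0 => y x v0.
rewrite !mul_block_col !mul1mx !dot_col /X mulmxDl -scalemxAl mul1mx !dotDr dotZr.
have [x0|x0 W] := eqVneq x 0; last by have : 0 < t * dot x x; [rewrite mulr_gt0// dot_gt0|lra].
move: v0; rewrite x0 col_mx_eq0 eqxx andbT => /pY'.
by rewrite mulmx0 !dot0l !dot0r mulr0 !addr0.
Qed.

(** * From a controller to synthesis variables *)

(** Selectors of the closed-loop groups: a group of plant channels together with the controller
    channels of the same index. *)
Definition ext1 (R : realType) l a (J : 'M[R]_(l, a)) c1 c2 : 'M[R]_(l + (c1 + c2), a + c1) :=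
  block_mx J 0 0 (col_mx 1%:M 0).

Definition ext2 (R : realType) l a (J : 'M[R]_(l, a)) c1 c2 : 'M[R]_(l + (c1 + c2), a + c2) :=
  block_mx J 0 0 (col_mx 0 1%:M).

Lemma ext22 (R : realType) l a (J : 'M[R]_(l, a)) c1 c2 :
  J^T *m J = 1%:M -> (ext2 J c1 c2)^T *m ext2 J c1 c2 = 1%:M.
Proof.
move=> JJ; rewrite /ext2 tr_block_mx !trmx0 tr_col_mx trmx1 trmx0 mulmx_block JJ mul_row_col.
by rewrite !(mulmx0, mul0mx, mulmx1, addr0, add0r) -scalar_mx_block.
Qed.

Lemma ext_split (R : realType) l a b (J1 : 'M[R]_(l, a)) (J2 : 'M[R]_(l, b)) c1 c2 :
  J1 *m J1^T + J2 *m J2^T = 1%:M ->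
  ext1 J1 c1 c2 *m (ext1 J1 c1 c2)^T + ext2 J2 c1 c2 *m (ext2 J2 c1 c2)^T = 1%:M.
Proof.
move=> JJ; rewrite /ext1 /ext2 !tr_block_mx !trmx0 !tr_col_mx !trmx1 !trmx0 !mulmx_block.
rewrite !mul_col_row !(mulmx0, mul0mx, mulmx1, addr0, add0r) add_block_mx JJ add_block_mx.
by rewrite !(addr0, add0r) -!scalar_mx_block.
Qed.

(** At x = 0 and d = 0 the inequality gives (P w) . (A w) < 0 for the closed-loop [A22], so P is
    injective. Moreover A maps the range of the second selector T2 into itself by triangularity, so
    a kernel vector v of T2^T P T2 would make this product vanish at w = T2 v. *)
Lemma multiplier_unit (R : realType) n l a b mp kp m k nc c1 c2 (gamma : R)
    (G : plant R n l l mp kp m k) (K : system R nc (c1 + c2) (c1 + c2) k m)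
    (X : 'M[R]_(n + nc)) (P : 'M[R]_(l + (c1 + c2)))
    (J1 : 'M[R]_(l, a)) (J2 : 'M[R]_(l, b)) :
  J1 *m J1^T + J2 *m J2^T = 1%:M -> J2^T *m J2 = 1%:M -> J1^T *m A22 G *m J2 = 0 ->
  zero_feedthrough K -> X^T = X -> P^T = P ->
  performance_lmi gamma X P (closed_loop G K) ->
  P \in unitmx /\ (ext2 J2 c1 c2)^T *m P *m ext2 J2 c1 c2 \in unitmx.
Proof.
move=> JJ J22 J12 [tA tB tC DK] sX sP /(performance_lmiP _ _ sX sP) lmi.
have lmiP w : w != 0 -> dot (P *m w) (A22 (closed_loop G K) *m w) < 0.
  move=> w0; have := lmi 0 w 0; rewrite !col_mx_eq0 eqxx (negbTE w0) => /(_ isT).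
  rewrite /perf_form !mulmx0 !dot0l !add0r !addr0 mulr0 add0r mulr0 subr0
    [dot (P *m w) _]dot_mull sP.
  by have := dot_ge0 (C2 (closed_loop G K) *m w); lra.
split; apply: unitmx_inj => v.
  move=> Pv; apply/eqP/negPn/negP => /lmiP; by rewrite Pv dot0l ltxx.
set T1 := ext1 J1 c1 c2; set T2 := ext2 J2 c1 c2; set A := A22 (closed_loop G K) in lmiP.
have T1AT2 : T1^T *m A *m T2 = 0.
  rewrite /A closed_loopE//= /T1 /T2 /ext1 /ext2 tr_block_mx !trmx0 tr_col_mx trmx1 trmx0.
  rewrite !mulmx_block !(mul0mx, mulmx0, addr0, add0r) J12.
  rewrite -!mulmxA -[C2 K]hsubmxK tC mul_row_col mulmx0 mul0mx addr0 !mulmx0.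
  rewrite -[B2 K]vsubmxK tB !mulmxA mul_row_col mulmx0 mul0mx addr0 !mul0mx.
  rewrite -[A22 K]submxK (tA : ursubmx _ = 0) mul_row_block mul_row_col.
  by rewrite !(mul0mx, mulmx0, mul1mx, addr0) block_mx0.
have AT2 : A *m T2 = T2 *m (T2^T *m A *m T2).
  rewrite -[LHS]mul1mx -(ext_split c1 c2 JJ) mulmxDl -!mulmxA [T1^T *m _]mulmxA T1AT2.
  by rewrite mulmx0 add0r.
move=> Nv; have [//|v0] := eqVneq v 0.
have : T2 *m v != 0.
  by apply: contra v0 => /eqP Tv; rewrite -[v]mul1mx -(ext22 c1 c2 J22) -mulmxA Tv mulmx0.
move=> /lmiP; rewrite [A *m _]mulmxA AT2 -[T2 *m _ *m v]mulmxA dotC dot_mull.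
by have -> : T2^T *m (P *m (T2 *m v)) = 0; rewrite ?dot0r ?ltxx// -Nv !mulmxA.
Qed.

Lemma invmx_sym (R : realType) n (A : 'M[R]_n) : A^T = A -> (invmx A)^T = invmx A.
Proof. by move=> sA; rewrite trmx_inv sA. Qed.

(** P3 and U are read off the first block column of P, Q1 and V off that of its inverse. The same
    choice serves the state multiplier. *)
Lemma outer_columns (R : realType) l c (P : 'M[R]_(l + c)) :
  P^T = P -> P \in unitmx ->
  exists P3 Q1 : 'M[R]_l, exists U V : 'M[R]_(c, l),
  [/\ P3^T = P3, Q1^T = Q1, P *m col_mx Q1 V = col_mx 1%:M 0 & P *m col_mx 1%:M 0 = col_mx P3 U].
Proof.
move=> sP uP.
have lcol (A : 'M[R]_(l + c)) : A *m col_mx 1%:M 0 = col_mx (ulsubmx A) (dlsubmx A).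
  by rewrite -{1}[A]submxK mul_block_col !mulmx1 !mulmx0 !addr0.
exists (ulsubmx P), (ulsubmx (invmx P)), (dlsubmx P), (dlsubmx (invmx P)).
by rewrite !trmx_ulsub sP invmx_sym// -!lcol mulKVmx.
Qed.

(* Block elimination of the second group (r2, s2, c2): the columns of the first group are
   corrected by the Schur complement. *)
Lemma middle_column (R : realType) r1 r2 s1 s2 c1 c2
    (P : 'M[R]_(r1 + r2 + (s1 + s2) + (c1 + c2))) :
  let T2 := ext2 (sel2 R r1 r2 s1 s2) c1 c2 in
  P^T = P -> T2^T *m P *m T2 \in unitmx ->
  exists (Pm : 'M[R]_(r1 + s1)) (Qm : 'M[R]_(r2 + s2)) (Rm : 'M[R]_(r2 + s2, r1 + s1)),
  exists (U : 'M[R]_(c1, _)) (V : 'M[R]_(c2, _)),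
  [/\ Pm^T = Pm, Qm^T = Qm &
    P *m col_mx (Q2_of Qm Rm) (col_mx 0 V) = col_mx (P2_of Pm Rm) (col_mx U 0)].
Proof.
move=> T2 sP uN.
set J1 := sel1 R r1 r2 s1 s2; set J2 := sel2 R r1 r2 s1 s2.
pose T1 := ext1 J1 c1 c2.
pose e1 := col_mx 1%:M 0 : 'M[R]_(r1 + s1 + c1, r1 + s1).
pose e2 := col_mx 1%:M 0 : 'M[R]_(r2 + s2 + c2, r2 + s2).
set N := T2^T *m P *m T2 in uN; pose W := invmx N.
have sW : W^T = W by rewrite /W invmx_sym// /N congr_sym.
pose S := T2^T *m P *m T1 *m e1.
(* The columns of [ma] are those of [T1 *m e1] made P-orthogonal to the range of T2, while T2^T P
   [mb] = [e2]. As [e1] and [e2] select only plant channels, the result has no entries in the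
   controller rows c1 and its image under P none in c2: these are the zeros that make V2 and U2
   triangular. *)
pose ma := T1 *m e1 - T2 *m (W *m S); pose mb := T2 *m (W *m e2).
have NW q (A : 'M_(_, q)) : T2^T *m (P *m (T2 *m (W *m A))) = A.
  by rewrite !mulmxA -/N mulmxV// mul1mx.
have Pma : T2^T *m (P *m ma) = 0.
  by rewrite /ma !mulmxBr NW /S !mulmxA subrr.
have e1E q (A : 'M_(_, q)) : e1^T *m A = usubmx A.
  by rewrite -{1}[A]vsubmxK tr_col_mx trmx1 trmx0 mul_row_col mul1mx mul0mx addr0.
have e2E q (A : 'M_(_, q)) : e2^T *m A = usubmx A.
  by rewrite -{1}[A]vsubmxK tr_col_mx trmx1 trmx0 mul_row_col mul1mx mul0mx addr0.
have T1E q (A : 'M_(_, q)) : T1 *m A = col_mx (J1 *m usubmx A) (col_mx (dsubmx A) 0).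
  rewrite -{1}[A]vsubmxK /T1 /ext1 mul_block_col (mul_col_mx 1%:M) !mul0mx mul1mx.
  by rewrite addr0 add0r.
have T2E q (A : 'M_(_, q)) : T2 *m A = col_mx (J2 *m usubmx A) (col_mx 0 (dsubmx A)).
  rewrite -{1}[A]vsubmxK /T2 /ext2 mul_block_col (mul_col_mx 0 1%:M) !mul0mx mul1mx.
  by rewrite addr0 add0r.
pose m := ma *m J1^T + mb *m J2^T.
(* Qm is the plant corner of the inverse pivot, Pm that of the Schur complement, and Rm that of the
   elimination coefficients. *)
pose Qm := e2^T *m (W *m e2); pose Rm := e2^T *m (W *m S).
pose Pm := e1^T *m (T1^T *m (P *m ma)).
pose g := T1^T *m (P *m m).
exists Pm, Qm, Rm, (dsubmx g), (dsubmx (W *m e2) *m J2^T - dsubmx (W *m S) *m J1^T).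
have sQm : Qm^T = Qm by rewrite /Qm !trmx_mul trmxK sW mulmxA.
have PmE : Pm = e1^T *m (T1^T *m P *m T1) *m e1 - S^T *m W *m S.
  by rewrite /Pm /ma /S !mulmxBr !trmx_mul sP trmxK !mulmxA.
split=> //.
  by rewrite PmE linearB /= congr_sym ?congr_sym// congr_sym.
have mE : m = col_mx (Q2_of Qm Rm)
    (col_mx 0 (dsubmx (W *m e2) *m J2^T - dsubmx (W *m S) *m J1^T)).
  rewrite /m /ma /mb T1E !T2E /e1 col_mxKu col_mxKd mulmx1 !opp_col_mx !add_col_mx.
  rewrite !(mul_col_mx _ _ (J1^T)) !(mul_col_mx _ _ (J2^T)) !add_col_mx Q2_ofE -/J1 -/J2.
  rewrite -!e2E -/Qm -/Rm !(oppr0, addr0, add0r, mul0mx); congr col_mx.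
    by rewrite mulmxBl.
  by congr col_mx; rewrite mulNmx addrC.
rewrite -mE.
have T2Pm : T2^T *m (P *m m) = e2 *m J2^T.
  by rewrite /m !mulmxDr ![P *m (_ *m _^T)]mulmxA ![T2^T *m (_ *m _^T)]mulmxA Pma NW mul0mx add0r.
have -> : P *m m = T1 *m g + T2 *m (e2 *m J2^T).
  by rewrite -T2Pm /g !mulmxA -!mulmxDl (ext_split c1 c2 (sel_split R r1 r2 s1 s2)) mul1mx.
rewrite T1E T2E /e2 (mul_col_mx 1%:M 0) mul1mx mul0mx col_mxKu col_mxKd !add_col_mx !addr0.
congr col_mx; rewrite P2_ofE -/J1 -/J2 -!mulmxA -mulmxDr; congr (_ *m _ + _).
have RmE : e1^T *m (T1^T *m (P *m mb)) = Rm^T.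
  by rewrite /mb /Rm /S !trmx_mul !trmxK sP sW !mulmxA.
by rewrite -e1E /g /m !mulmxDr ![P *m (_ *m _^T)]mulmxA ![T1^T *m (_ *m _^T)]mulmxA
  ![e1^T *m (_ *m _^T)]mulmxA RmE.
Qed.

(** On such columns the unknown scheduling values drop out. For the outer columns this holds because
    U or V is zero, for the middle column because the scheduling function is lower block
    triangular. *)
Lemma scheduling_column (R : realType) l c (P : 'M[R]_(l + c)) (Dl C Z : 'M[R]_l)
    (Dc : 'M[R]_c) (V U : 'M[R]_(c, l)) x :
  P^T = P -> P *m col_mx C V = col_mx Z U -> U^T *m (Dc *m V) = 0 ->
  dot (col_mx C V *m x) (P *m (diag2 Dl Dc *m (col_mx C V *m x))) =
  dot x (Z^T *m Dl *m C *m x).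
Proof.
move=> sP PE UV; rewrite -{1}sP -dot_mull mulmxA PE (mul_col_mx C V) (mul_col_mx Z U)
  /diag2 mul_block_col.
rewrite !mul0mx addr0 add0r dot_col !dot_mull [U^T *m _]mulmxA.
by rewrite -[_ *m (V *m x)]mulmxA [Dc *m _]mulmxA [U^T *m _]mulmxA UV mul0mx dot0r addr0 !mulmxA.
Qed.

Lemma lower_block_mul (R : realType) a1 a2 b1 b2 c1 c2 (A : 'M[R]_(a1 + a2, b1 + b2))
    (B : 'M[R]_(b1 + b2, c1 + c2)) :
  lower_block_triangular A -> lower_block_triangular B -> lower_block_triangular (A *m B).
Proof.
rewrite /lower_block_triangular => A0 B0; rewrite -[A]submxK -[B]submxK A0 B0 mulmx_block.
by rewrite block_mxKur mulmx0 mul0mx addr0.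
Qed.

(** The new variables are given by explicit formulas; the point is their structure. In the (1,2)
    block of the formula for [A22] every term with a controller matrix vanishes, leaving exactly
    what [upper_part] subtracts. *)
Lemma design_variables (R : realType) n l mp kp m k nc c1 c2 (G : plant R n l l mp kp m k)
    (K : system R nc (c1 + c2) (c1 + c2) k m) (X1 Y1 : 'M[R]_n) (U1 V1 : 'M[R]_(nc, n))
    (X2 Y2 : 'M[R]_(l, l + l)) (U2 V2 : 'M[R]_(c1 + c2, l + l)) :
  zero_feedthrough K -> lower_block_triangular U2^T -> lower_block_triangular V2 ->
  exists2 Kd : system R n (l + l) (l + l) k m, zero_feedthrough Kd &
  [/\ B1 Kd = U1^T *m B1 K, B2 Kd = U2^T *m B2 K,
  C1 Kd = C1 K *m V1 & C2 Kd = C2 K *m V2] /\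
  [/\ A11 Kd = X1^T *m A11 G *m Y1 + X1^T *m Bu1 G *m (C1 K *m V1)
           + U1^T *m B1 K *m (Cy1 G *m Y1) + U1^T *m A11 K *m V1,
  A12 Kd = X1^T *m A12 G *m Y2 + X1^T *m Bu1 G *m (C2 K *m V2)
           + U1^T *m B1 K *m (Cy2 G *m Y2) + U1^T *m A12 K *m V2,
  A21 Kd = X2^T *m A21 G *m Y1 + X2^T *m Bu2 G *m (C1 K *m V1)
           + U2^T *m B2 K *m (Cy1 G *m Y1) + U2^T *m A21 K *m V1 &
  A22 Kd + upper_part (X2^T *m A22 G *m Y2) =
           X2^T *m A22 G *m Y2 + X2^T *m Bu2 G *m (C2 K *m V2)
           + U2^T *m B2 K *m (Cy2 G *m Y2) + U2^T *m A22 K *m V2].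
Proof.
move=> [tA tB tC DK] tU tV.
have tB' : usubmx (U2^T *m B2 K) = 0.
  rewrite -[U2^T]submxK -[B2 K]vsubmxK tB (tU : ursubmx _ = 0) mul_block_col col_mxKu.
  by rewrite mulmx0 mul0mx addr0.
have tC' : rsubmx (C2 K *m V2) = 0.
  rewrite -[V2]submxK -[C2 K]hsubmxK tC (tV : ursubmx _ = 0) mul_row_block row_mxKr.
  by rewrite mulmx0 mul0mx addr0.
have tA' : lower_block_triangular (U2^T *m A22 K *m V2) by do 2!apply: lower_block_mul => //.
exists (System
  (X1^T *m A11 G *m Y1 + X1^T *m Bu1 G *m (C1 K *m V1)
    + U1^T *m B1 K *m (Cy1 G *m Y1) + U1^T *m A11 K *m V1)
  (X1^T *m A12 G *m Y2 + X1^T *m Bu1 G *m (C2 K *m V2)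
    + U1^T *m B1 K *m (Cy2 G *m Y2) + U1^T *m A12 K *m V2)
  (U1^T *m B1 K)
  (X2^T *m A21 G *m Y1 + X2^T *m Bu2 G *m (C1 K *m V1)
    + U2^T *m B2 K *m (Cy1 G *m Y1) + U2^T *m A21 K *m V1)
  (X2^T *m A22 G *m Y2 + X2^T *m Bu2 G *m (C2 K *m V2)
    + U2^T *m B2 K *m (Cy2 G *m Y2) + U2^T *m A22 K *m V2
    - upper_part (X2^T *m A22 G *m Y2))
  (U2^T *m B2 K) (C1 K *m V1) (C2 K *m V2) 0); last by rewrite /= subrK.
split; [|exact: tB'|exact: tC'|by []].
rewrite /lower_block_triangular [A22 _]/= !(ursubD, ursubN).
rewrite [ursubmx (_ *m (C2 K *m V2))]mul_ursubmx tC' mulmx0 addr0.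
rewrite [ursubmx (_ *m (Cy2 G *m Y2))]mul_ursubmx tB' mul0mx addr0 tA' addr0.
by rewrite /upper_part block_mxKur subrr.
Qed.

Lemma sel1T_Q2 (R : realType) r1 r2 s1 s2 (Q : 'M[R]_(r2 + s2)) (Rm : 'M[R]_(r2 + s2, r1 + s1)) :
  (sel1 R r1 r2 s1 s2)^T *m Q2_of Q Rm = (sel1 R r1 r2 s1 s2)^T.
Proof.
by rewrite Q2_ofE !(mulmxDr, mulmxN, mulmxA) sel11 sel12 !mul1mx !mul0mx subr0 addr0.
Qed.

Lemma sel2T_P2 (R : realType) r1 r2 s1 s2 (P : 'M[R]_(r1 + s1)) (Rm : 'M[R]_(r2 + s2, r1 + s1)) :
  (sel2 R r1 r2 s1 s2)^T *m P2_of P Rm = (sel2 R r1 r2 s1 s2)^T.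
Proof. by rewrite P2_ofE !(mulmxDr, mulmxA) sel21 sel22 !mul1mx !mul0mx !add0r. Qed.

Lemma design_necessary (R : realType) n m k mp kp rD sD (V : set 'M[R]_(rD, sD))
    (G : plant R n (rD + rD) (sD + sD) mp kp m k) (gamma : R) nc c1 c2
    (K : system R nc (c1 + c2) (c1 + c2) k m) (Dc : 'M[R]_(rD, sD) -> 'M[R]_(c1 + c2))
    (X : 'M[R]_(n + nc)) (P : 'M[R]_((rD + rD) + (sD + sD) + (c1 + c2))) :
  V 0 -> class_G4 G -> robust_controller V G gamma K Dc X P -> design_conditions V G gamma.
Proof.
move=> V0 [tG _ _ _] [[zK tDc] pX /full_scalingsP[sP fP] lmi].
have DK : D K = 0 by case: zK.
have /posdefP[sX fX] := pX.
have [uP uN] := multiplier_unit (sel_split R rD rD sD sD) (sel22 R rD rD sD sD)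
  (lifted_A22_sel tG) zK sX sP lmi.
have [X1 [Y1 [U1 [V1 [sX1 sY1 XV XU]]]]] := outer_columns sX (posform_unit fX).
have [P3 [Q1 [U3 [W1 [sP3 sQ1 PW PU]]]]] := outer_columns sP uP.
have [Pm [Qm [Rm [U [W [sPm sQm PM]]]]]] := middle_column sP uN.
set P2 := P2_of Pm Rm in PM; set Q2 := Q2_of Qm Rm in PM.
set l := ((rD + rD) + (sD + sD))%N.
pose T1 := block_mx Y1 1%:M V1 0 : 'M[R]_(n + nc, n + n).
have XE : T1^T *m X = (block_mx 1%:M X1 0 U1)^T.
  rewrite -[X]sX -trmx_mul; congr trmx.
  by rewrite /T1 !block_mxEh mul_mx_row XV XU.
pose V2 := row_mx W1 (col_mx 0 W) : 'M[R]_(c1 + c2, l + l).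
pose U2 := row_mx (col_mx U 0) U3 : 'M[R]_(c1 + c2, l + l).
pose T2 := block_mx (row_mx Q1 Q2) 1%:M V2 0 : 'M[R]_(l + (c1 + c2), (l + l) + l).
have PE : T2^T *m P = regroup (block_mx 1%:M (row_mx P2 P3) 0 U2)^T.
  rewrite -[P]sP -trmx_mul.
  have -> : T2 = row_mx (row_mx (col_mx Q1 W1) (col_mx Q2 (col_mx 0 W))) (col_mx 1%:M 0).
    by rewrite /T2 block_mxEh -[row_mx (col_mx Q1 _) _]block_mxEh.
  have -> : block_mx 1%:M (row_mx P2 P3) 0 U2 =
      row_mx (col_mx 1%:M 0) (row_mx (col_mx P2 (col_mx U 0)) (col_mx P3 U3)).
    by rewrite block_mxEh -[row_mx (col_mx P2 _) _]block_mxEh.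
  by rewrite !mul_mx_row PW PM PU !tr_row_mx regroup_col.
have tV2 : lower_block_triangular V2.
  by rewrite /lower_block_triangular -usub_rsub /V2 row_mxKr col_mxKu.
have tU2 : lower_block_triangular U2^T.
  rewrite /lower_block_triangular /U2 tr_row_mx tr_col_mx trmx0 /ursubmx.
  by rewrite col_mxKu row_mxKr.
have [Kd zKd [[B1E B2E C1E C2E] [A11E A12E A21E A22E]]] :=
  design_variables (lifted_plant G) X1 Y1 U1 V1 (row_mx P2 P3) (row_mx Q1 Q2) zK tU2 tV2.
have DKd : D Kd = 0 by case: zKd.
have Xpos x : x != 0 -> 0 < dot (X *m x) x by move=> /fX; rewrite dotC.
have pY1 : posdef Y1.
  apply/posdefP; split=> // y y0.
  have := @Xpos (col_mx Y1 V1 *m y); rewrite mulmxA XV !mul_col_mx mul1mx mul0mx.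
  rewrite dot_col dot0l addr0; apply; apply: contra y0 => /eqP c0.
  have := congr1 (mulmx X) c0; rewrite -mul_col_mx mulmxA XV mul_col_mx mul1mx mulmx0.
  by move/eqP; rewrite col_mx_eq0 => /andP[].
have primalP3 : primal_scalings V P3.
  apply: primal_scalingsI => // M x VM x0.
  have := scheduling_column (Delta_l M) (Dc := Dc M) x sP (etrans PU (erefl _)).
  rewrite !mulmx0 => /(_ erefl); rewrite sP3 mulmx1 -!mulmxA => <-; apply: fP => //.
  by rewrite mul_col_mx mul1mx col_mx_eq0 negb_and x0.
have dualQ1 : dual_scalings V Q1.
  apply: dual_scalingsI => // M x VM x0.
  have := scheduling_column (Delta_l M) (Dc := Dc M) x sP PW.
  rewrite trmx0 mul0mx trmx1 mul1mx => /(_ erefl).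
  rewrite -[dot x (Delta_l M *m Q1 *m x)]dotC [dot (Delta_l M *m Q1 *m x) x]dot_mull.
  rewrite trmx_mul sQ1 -[Q1 *m _ *m x]mulmxA => <-.
  apply: fP => //; apply: contra x0 => /eqP c0.
  have := congr1 (mulmx P) c0; rewrite mulmxA PW mul_col_mx mul1mx mulmx0.
  by move/eqP; rewrite col_mx_eq0 => /andP[].
have middle M x : V M -> x != 0 -> 0 < dot x (P2^T *m Delta_l M *m Q2 *m x).
  move=> VM x0; have UV : (col_mx U 0)^T *m (Dc M *m col_mx 0 W) = 0.
    rewrite -[Dc M]submxK (tDc M VM : ursubmx _ = 0) mul_block_col !mulmx0 mul0mx !add0r.
    by rewrite tr_col_mx trmx0 mul_row_col mulmx0 mul0mx add0r.
  rewrite -(scheduling_column (Delta_l M) x sP PM UV).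
  apply: fP => //; apply: contra x0 => /eqP c0.
  have := congr1 (mulmx P) c0; rewrite mulmxA PM mul_col_mx mulmx0.
  move/eqP; rewrite col_mx_eq0 => /andP[/eqP P2x _].
  move/eqP: c0; rewrite mul_col_mx col_mx_eq0 => /andP[/eqP Q2x _].
  (* The identity rows of Q2 in the first group and of P2 in the second recover all of x from Q2 x =
     0 and P2 x = 0. *)
  rewrite -[x]mul1mx -(sel_split R rD rD sD sD) mulmxDl -!mulmxA.
  rewrite -(sel1T_Q2 Qm Rm) -(sel2T_P2 Pm Rm) -/P2 -/Q2.
  by rewrite -[_ *m Q2 *m x]mulmxA -[_ *m P2 *m x]mulmxA Q2x P2x !mulmx0 addr0.
have unit_pos (A B : 'M[R]_l) : (forall x, x != 0 -> 0 < dot x (A *m (B *m x))) -> A \in unitmx.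
  move=> H; have : A *m B \in unitmx by apply: posform_unit => x; rewrite -mulmxA; apply: H.
  by rewrite unitmx_mul => /andP[].
have uQ1 : Q1 \in unitmx.
  by apply: (unit_pos _ (Delta_l 0)^T) => x; apply: (dual_scalings_form dualQ1).
have uQ2 : Q2 \in unitmx.
  have : P2^T *m Delta_l 0 *m Q2 \in unitmx by apply: posform_unit => x; apply: middle.
  by rewrite unitmx_mul => /andP[].
have uY1 : Y1 \in unitmx by case/posdefP: pY1 => _; apply: posform_unit.
have [c c0 Hc] := performance_lmi_coercive sX sP lmi.
have [Kd' zKd' lmi'] : exists2 K', zero_feedthrough K' & performance_lmi gamma 1%:M 1%:M
    (design_system (lifted_plant G) X1 Y1 (row_mx P2 P3) (row_mx Q1 Q2) K').
  apply: (design_strict zKd sY1 sQ1 uY1 uQ1 uQ2 c0) => x1 x2 w1 w2 w3 d.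
  rewrite (perf_form_design gamma _ _ d XE PE DK DKd B1E B2E C1E C2E A11E A12E A21E A22E).
  apply: (le_trans (Hc _ _ _)).
  (* Only the first block rows of the transformations are kept in the bound, since nothing is known
     about V1 and V2. *)
  rewrite lerN2 ler_pM2l// /T1 /T2 !mul_block_col !mul1mx !mul0mx !addr0 mul_row_col !dot_col.
  by rewrite lerD2r lerD// ?lerDl ?dot_ge0.
have W0 v : 0 <= dot v (block_mx Y1 1%:M 1%:M X1 *m v).
  have WE : T1^T *m X *m T1 = block_mx Y1 1%:M (X1^T *m Y1 + U1^T *m V1) X1.
    rewrite XE tr_block_mx mulmx_block trmx1 trmx0 !mul1mx !mulmx1 !mul0mx !mulmx0 !addr0.
    by rewrite sX1.
  (* Symmetry of T1^T X T1 forces its lower left block to be the transpose of the upper right one.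
     As T1 may be singular, this yields only semidefiniteness of the coupling matrix. *)
  have WE' : X1^T *m Y1 + U1^T *m V1 = 1%:M.
    have := congr_sym T1 sX; rewrite WE tr_block_mx => /eq_block_mx[_ _ <- _].
    by rewrite trmx1.
  rewrite WE' in WE; rewrite -WE dot_congr.
  have [->|/Xpos/ltW] := eqVneq (T1 *m v) 0; first by rewrite dot0l.
  by rewrite dotC.
have DKd' : D Kd' = 0 by case: zKd'.
have [X1' [sX1' pd lmi'']] := design_coupling_strict DKd' sX1 pY1 W0 lmi'.
exists X1', Y1, P3, Q1, Pm, Qm, Rm, Kd'; split=> //.
- by split; apply/symmetricmxP.
- by split=> //; apply/symmetricmxP.
- by move=> M VM; apply/symm_part_posdefP => x; apply: middle.
Qed.

Theorem theorem8 (R : realType) (n m k mp kp rD sD N : nat)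
    (Delta : 'I_N -> 'M[R]_(rD, sD)) (V0 : convex_hull Delta 0)
    (G : plant R n (rD + rD) (sD + sD) mp kp m k) (hG : class_G4 G)
    (gamma : R) (gamma_gt0 : 0 < gamma) :
  let V := convex_hull Delta in
  ((exists (nc lc1 lc2 : nat) (K : system R nc (lc1 + lc2) (lc1 + lc2) k m)
      (Dc : 'M[R]_(rD, sD) -> 'M[R]_(lc1 + lc2))
      (X1 : 'M[R]_(n + nc)) (P : 'M[R]_((rD + rD) + (sD + sD) + (lc1 + lc2))),
      robust_controller V G gamma K Dc X1 P)
   <-> design_conditions V G gamma)
  /\
  (design_conditions V G gamma ->
   let l := ((rD + rD) + (sD + sD))%N in
   exists (nc lc1 lc2 : nat) (K : system R nc (lc1 + lc2) (lc1 + lc2) k m)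
      (Dc : 'M[R]_(rD, sD) -> 'M[R]_(lc1 + lc2))
      (X1 : 'M[R]_(n + nc)) (P : 'M[R]_((rD + rD) + (sD + sD) + (lc1 + lc2))),
      [/\ robust_controller V G gamma K Dc X1 P, affine_on V Dc,
          (nc <= n)%N & (lc1 + lc2 <= 2 * l)%N]).
Proof.
move=> V.
have sufficient : design_conditions V G gamma ->
    let l := ((rD + rD) + (sD + sD))%N in
    exists (nc lc1 lc2 : nat) (K : system R nc (lc1 + lc2) (lc1 + lc2) k m)
      (Dc : 'M[R]_(rD, sD) -> 'M[R]_(lc1 + lc2))
      (X1 : 'M[R]_(n + nc)) (P : 'M[R]_((rD + rD) + (sD + sD) + (lc1 + lc2))),
      [/\ robust_controller V G gamma K Dc X1 P, affine_on V Dc,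
          (nc <= n)%N & (lc1 + lc2 <= 2 * l)%N].
  move=> /(design_sufficient V0)[K [Dc [X1 [P [rob aff]]]]] l.
  by exists n, l, l, K, Dc, X1, P; split=> //; rewrite mul2n addnn.
split=> //; split; last first.
  by move=> /sufficient[nc [lc1 [lc2 [K [Dc [X1 [P [rob _ _ _]]]]]]]];
    exists nc, lc1, lc2, K, Dc, X1, P.
by case=> [nc [lc1 [lc2 [K [Dc [X1 [P rob]]]]]]]; apply: design_necessary rob.
Qed.
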